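(* For all positive integers $m$ and $s$, $$N(G_2,m,s)=\frac1{|W|}\sum_{c\in\operatorname{Cl}(W)}|c|\sum_{\substack{S\in\mathcal M\\ s(S)=s\\ S\preceq S_{w_c}}}f_m(S),$$ where, for every $S\in\mathcal M$, $f_m(S)$ can be computed by $$f_m(S)=\sum_{\substack{T'\preceq S\\ T'\in\mathcal M}}\mu(T',S)\,g_m(T').$$
   Context: $G_2$ is the complex connected simply-connected simple Lie group of type $G_2$ in its 7-dimensional faithful representation. In a suitable basis its maximal torus $T$ consists of the matrices $t(k_{\delta_1},k_{\delta_2})=\operatorname{diag}(e^{2\pi iP_1},e^{2\pi iP_2},e^{2\pi iP_3},1,e^{-2\pi iP_3},e^{-2\pi iP_2},e^{-2\pi iP_1})$ with $P_1=k_{\delta_1}$, $P_2=-(k_{\delta_1}-k_{\delta_2})$, $P_3=2k_{\delta_1}-k_{\delta_2}$ ($\delta_1,\delta_2$ the simple roots, $k_{\delta_i}$ taken modulo $\mathbb Z$). Elements of $T$ of order dividing $m$ are those with $(k_{\delta_1},k_{\delta_2})\in(\frac1m\mathbb Z/\mathbb Z)^2$. $W$ is the Weyl group (of order 12), acting on $T$ by conjugation; $\operatorname{Cl}(W)$ is its set of conjugacy classes and $w_c$ a chosen representative of $c$. $N(G_2,m,s)$ is the number of conjugacy classes of $G_2$ in $\{x\in G_2: x^m=1,\ x\text{ has exactly }s\text{ distinct eigenvalues}\}$. Let $\vec v_1=[1\ \ 0]$, $\vec v_2=[-1\ \ 1]$, $\vec v_3=[2\ \ {-1}]$, and let $P$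 be the $9\times2$ matrix whose rows are the distinct vectors, up to sign, among $\vec v_i\pm\vec v_j$ ($i<j$), $\vec v_i$, $2\vec v_i$; namely the rows $(1,0),(1,-1),(2,-1),(2,0),(0,1),(3,-1),(2,-2),(3,-2),(4,-2)$. $\mathcal S$ is the set of $k\times2$ submatrices of $P$, $0\le k\le9$ (subsets of rows, including the empty submatrix, whose kernel is everything), partially ordered by $S_1\preceq S_2$ iff $S_2$ is a submatrix of $S_1$. $\mathcal M\subseteq\mathcal S$ is the subposet of those $S$ such that every row of $P$ that is an integer combination of rows of $S$ is a row of $S$. For $S\in\mathcal S$, $g_m(S)=|\{\vec k\in(\frac1m\mathbb Z/\mathbb Z)^2:S\vec k=\vec0\}|$ and $f_m(S)=|\{\vec k\in(\frac1m\mathbb Z/\mathbb Z)^2:S\vec k=\vec0,\ T'\vec k\ne\vec0\text{ for all }T'\prec S\}|$. $\mu$ is the Möbius function of $\mathcal M$: $\mu(S,S)=1$, $\mu(T',S)=-\sum_{T'\preceq U\prec S,\,U\in\mathcal M}\mu(T',U)$ if $T'\prec S$, and $0$ otherwise. For $S\in\mathcal S$, $\equiv_S$ is the equivalence relation on $H=\{0,\frac12,1,2,3\}$ determined by the rules (for $i,j\in\{1,2,3\}$): $i\equiv_Sj$ if $\vec v_i+\vec v_j$ or $\vec v_i-\vec v_j$ is (up to sign) a row of $S$; $i\equiv_S0$ if $\vec v_i$ is (up to sign) a row of $S$; $i\equiv_S\frac12$ if $2\vec v_i$ is (up to sign) a row of $S$ but $\vec v_i$ is not. $s(S)=2|H/{\equiv_S}|-3$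 if the class $[\frac12]$ has one element, and $s(S)=2|H/{\equiv_S}|-2$ otherwise. For $w\in W$, let $\sigma_w$ be the signed permutation of $\{1,2,3\}$ such that the $i$th diagonal entry ($i=1,2,3$) of $w\cdot t(k_{\delta_1},k_{\delta_2})$ is $e^{2\pi iP_{\sigma_w(i)}}$ if $\sigma_w(i)>0$ and $e^{-2\pi iP_{-\sigma_w(i)}}$ if $\sigma_w(i)<0$. $S_w\in\mathcal S$ is the (possibly empty) matrix whose rows are the distinct vectors, up to sign, obtained for $i=1,2$ by: $2\vec v_i$ if $\sigma_w(i)=-i$; $\vec v_i\mp\vec v_j$ if $\sigma_w(i)=\pm j$, $j\in\{1,2,3\}$, $j\neq i$. *)

(* Defs.v *)
Set Warnings "-notation-overridden,-ambiguous-paths,-notation-incompatible-prefix".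
From HB Require Import structures.
From mathcomp Require Import all_boot all_order all_fingroup all_algebra.
From mathcomp Require Import boolp classical_sets functions cardinality reals.
From mathcomp Require Import sequences exp trigo.
From mathcomp Require Import complex ring zify.
Set Implicit Arguments.
Unset Strict Implicit.
Unset Printing Implicit Defensive.

Import Order.TTheory GRing.Theory Num.Theory.
Local Open Scope ring_scope.

(* G2 is realised as the automorphism group of the complex octonions, acting on
   the 7-dimensional space of imaginary octonions.  The octonions are presented
   as Zorn's vector matrices ((a, u), (v, b)); by znormM they form an
   8-dimensional composition algebra. *)

Section Octonions.
Variable F : fieldType.

Record zorn := Zorn { zA : F; zU : 'cV[F]_3; zV : 'cV[F]_3; zB : F }.

Definition dot (u v : 'cV[F]_3) : F := \sum_i u i 0 * v i 0.

(* 'I_3 is used here as the ring Z/3Z, so that i + 1 and i + 2 are cyclic. *)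
Definition cross (u v : 'cV[F]_3) : 'cV[F]_3 :=
  \col_(i < 3) (u (i + 1) 0 * v (i + 2) 0 - u (i + 2) 0 * v (i + 1) 0).

Definition zmul (z w : zorn) : zorn :=
  Zorn (zA z * zA w + dot (zU z) (zV w))
       (zA z *: zU w + zB w *: zU z - cross (zV z) (zV w))
       (zA w *: zV z + zB z *: zV w + cross (zU z) (zU w))
       (zB z * zB w + dot (zV z) (zU w)).

Definition znorm (z : zorn) : F := zA z * zB z - dot (zU z) (zV z).

Lemma znormM (z w : zorn) : znorm (zmul z w) = znorm z * znorm w.
Proof.
case: z w => [a u v b] [c x y d]; rewrite /znorm /zmul /dot /cross /=.
have sum3 (f : 'I_3 -> F) : \sum_i f i = f 0 + f 1 + f 2.
  rewrite !big_ord_recl big_ord0 addr0 addrA.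
  by congr (f _ + f _ + f _); apply: val_inj.
have E11 : 1 + 1 = 2 :> 'I_3 by apply: val_inj.
have E12 : 1 + 2 = 0 :> 'I_3 by apply: val_inj.
have E21 : 2 + 1 = 0 :> 'I_3 by apply: val_inj.
have E22 : 2 + 2 = 1 :> 'I_3 by apply: val_inj.
rewrite !sum3 !mxE !add0r !E11 !E12 !E21 !E22; ring.
Qed.

(* The splitting of the octonions as F.1 + (imaginary octonions).  The ordered
   basis of the imaginary octonions is u_0, v_1, v_2, (1, -1), u_2, u_1, v_0;
   the torus below acts on it with weights P1, P2, P3, 0, -P3, -P2, -P1, which
   is compatible with the product because P1 = P2 + P3. *)
Definition oct (c : F) (x : 'cV[F]_7) : zorn :=
  let X i := x (inord i) 0 in
  Zorn (c + X 3%N)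
       (\col_(i < 3) nth 0 [:: X 0%N; X 5%N; X 4%N] i)
       (\col_(i < 3) nth 0 [:: X 6%N; X 1%N; X 2%N] i)
       (c - X 3%N).

Definition oct_re (z : zorn) : F := (zA z + zB z) / 2.

Definition oct_im (z : zorn) : 'cV[F]_7 :=
  let U i := zU z (inord i) 0 in
  let V i := zV z (inord i) 0 in
  \col_(i < 7) nth 0
    [:: U 0%N; V 1%N; V 2%N; (zA z - zB z) / 2; U 2%N; U 1%N; V 0%N] i.

Definition oct_act (A : 'M[F]_7) (z : zorn) : zorn :=
  oct (oct_re z) (A *m oct_im z).

End Octonions.

Section G2.
Variable R : realType.
Local Notation C := (complex R).
Local Open Scope classical_set_scope.

(* Every algebra automorphism of the octonions fixes 1 and preserves the space
   of imaginary octonions, so it is oct_act A for a unique matrix A. *)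
Definition G2 : set 'M[C]_7 :=
  [set A | A \in unitmx /\
    forall z w, oct_act A (zmul z w) = zmul (oct_act A z) (oct_act A w)].

Definition conj_class (x : 'M[C]_7) : set 'M[C]_7 :=
  [set g *m x *m invmx g | g in G2].

Definition distinct_eigenvalues (x : 'M[C]_7) (s : nat) : Prop :=
  ([set a | eigenvalue x a] #= `I_s)%card.

Definition G2_elements (m s : nat) : set 'M[C]_7 :=
  [set x | [/\ G2 x, x ^+ m = 1 & distinct_eigenvalues x s]].

Definition G2_classes (m s : nat) : set (set 'M[C]_7) :=
  [set conj_class x | x in G2_elements m s].

(* e2pi z is exp (2 pi i z). *)
Definition e2pi (z : C) : C :=
  (expR (- (2 * pi * complex.Im z)))%:C%C *
  Complex (cos (2 * pi * complex.Re z)) (sin (2 * pi * complex.Re z)).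

Definition v (i : 'I_3) : 'rV[int]_2 :=
  \row_(j < 2) nth 0 (nth [::] [:: [:: 1; 0]; [:: -1; 1]; [:: 2; -1]] i) j.

(* wt i k is P_(i+1) evaluated at k. *)
Definition wt (i : 'I_3) (k : 'cV[C]_2) : C :=
  (map_mx intr (v i) *m k) 0 0.

Definition torus_elt (k : 'cV[C]_2) : 'M[C]_7 :=
  let p i := wt (inord i) k in
  diag_mx (\row_(j < 7) nth 0
    [:: e2pi (p 0%N); e2pi (p 1%N); e2pi (p 2%N); 1;
        e2pi (- p 2%N); e2pi (- p 1%N); e2pi (- p 0%N)] j).

Definition torus : set 'M[C]_7 := range torus_elt.

Definition torus_normalizer : set 'M[C]_7 :=
  [set n | G2 n /\ [set n *m t *m invmx n | t in torus] = torus].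

(* q exhibits W as the quotient N(T) / T: it is a morphism on N(T), it maps
   N(T) onto W, and its kernel is T.  The element q n of W acts on T by
   t |-> n t n^-1. *)
Definition is_weyl_group (gT : finGroupType) (W : {group gT})
    (q : 'M[C]_7 -> gT) : Prop :=
  [/\ forall n1 n2, torus_normalizer n1 -> torus_normalizer n2 ->
        q (n1 *m n2) = (q n1 * q n2)%g,
      q @` torus_normalizer = [set w | w \in W]
    & forall n, torus_normalizer n -> (q n = 1%g <-> torus n)].

(* The pair (p, neg) stands for the signed permutation i |-> p i if ~~ neg i,
   and i |-> - p i if neg i. *)
Definition signed_perm3 := ({perm 'I_3} * {ffun 'I_3 -> bool})%type.

Definition is_sigma (gT : finGroupType) (q : 'M[C]_7 -> gT) (w : gT)
    (sg : signed_perm3) : Prop :=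
  forall n k (i : 'I_3), torus_normalizer n -> q n = w ->
    let d := widen_ord (isT : (3 <= 7)%N) i in
    (n *m torus_elt k *m invmx n) d d =
    e2pi ((-1) ^+ sg.2 i * wt (sg.1 i) k).

(* For w in W there is exactly one such signed permutation. *)
Definition sigma (gT : finGroupType) (q : 'M[C]_7 -> gT) (w : gT) :
    signed_perm3 :=
  odflt (1%g, [ffun=> false]) [pick sg | `[< is_sigma q w sg >]].

End G2.

Definition P : 'M[int]_(9, 2) :=
  \matrix_(r < 9, j < 2) nth 0 (nth [::]
    [:: [:: 1; 0]; [:: 1; -1]; [:: 2; -1]; [:: 2; 0]; [:: 0; 1];
        [:: 3; -1]; [:: 2; -2]; [:: 3; -2]; [:: 4; -2]] r) j.

(* A submatrix is given by the set of the indices of its rows. *)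
Definition submat := {set 'I_9}.

Definition preceq (S1 S2 : submat) : bool := S2 \subset S1.
Definition prec (S1 S2 : submat) : bool := S2 \proper S1.

Definition int_comb (S : submat) (x : 'rV[int]_2) : Prop :=
  exists c : 'I_9 -> int, x = \sum_(r in S) c r *: row r P.

Definition Mposet : {set submat} :=
  [set S : submat | [forall r, `[< int_comb S (row r P) >] ==> (r \in S)]].

(* A point a of ('I_m)^2 stands for k = a / m in ((1/m)Z / Z)^2. *)
Definition row_kills (m : nat) (r : 'I_9) (a : {ffun 'I_2 -> 'I_m}) : bool :=
  (m %| \sum_j P r j * (a j)%:Z)%Z.

Definition kills (m : nat) (S : submat) (a : {ffun 'I_2 -> 'I_m}) : bool :=
  [forall r in S, row_kills r a].

Definition g_ (m : nat) (S : submat) : nat :=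
  #|[set a : {ffun 'I_2 -> 'I_m} | kills S a]|.

Definition f_ (m : nat) (S : submat) : nat :=
  #|[set a : {ffun 'I_2 -> 'I_m} |
      kills S a && [forall T : submat, prec T S ==> ~~ kills T a]]|.

(* The recursion defining mu, with fuel n; see muE. *)
Fixpoint mu_rec (n : nat) (T S : submat) : int :=
  if T == S then 1
  else if prec T S then
    if n is n'.+1 then
      - \sum_(U in Mposet | preceq T U && prec U S) mu_rec n' T U
    else 0
  else 0.

Definition mu (T S : submat) : int := mu_rec 9 T S.

Lemma muE (T S : submat) :
  mu T S = if T == S then 1
           else if prec T S then
             - \sum_(U in Mposet | preceq T U && prec U S) mu T U
           else 0.
Proof.
have fuel n m (S0 : submat) : (#|T| - #|S0| <= n)%N -> (#|T| - #|S0| <= m)%N ->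
    mu_rec n T S0 = mu_rec m T S0.
  have pos0 S1 : prec T S1 -> (#|T| - #|S1| <= 0)%N = false.
    by move/proper_card => lt; rewrite leqn0 subn_eq0 leqNgt lt.
  elim: n m S0 => [|n IHn] [|m] S0 //= hn hm; case: eqP => // nTS;
    case: ifP => // pTS; rewrite ?(pos0 _ pTS) // in hn hm.
  congr (- _); apply: eq_bigr => U /andP[_ /andP[_ /proper_card US]].
  by apply: IHn; move: US hn hm; move: #|T| #|S0| #|U| => a b c; lia.
have unfold n : (#|T| <= n.+1)%N -> mu_rec n.+1 T S =
    if T == S then 1 else if prec T S then
      - \sum_(U in Mposet | preceq T U && prec U S) mu_rec n.+1 T U else 0.
  move=> leT; rewrite {1}/mu_rec -/mu_rec.
  case: eqP => // _; case: ifP => // _.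
  congr (- _); apply: eq_bigr => U /andP[_ /andP[_ /proper_card US]].
  by apply: fuel; move: US leT; move: #|T| #|S| #|U| => a b c; lia.
apply: (unfold 8%N).
by have := max_card (mem T); rewrite card_ord.
Qed.

Definition is_row (S : submat) (x : 'rV[int]_2) : bool :=
  [exists r in S, (row r P == x) || (row r P == - x)].

(* The set {0, 1/2, 1, 2, 3}: inl false is 0, inl true is 1/2, and inr i is
   the index of v i. *)
Definition Hset : finType := (bool + 'I_3)%type.

Definition H_rule (S : submat) (x y : Hset) : bool :=
  match x, y with
  | inr i, inr j => is_row S (v i + v j) || is_row S (v i - v j)
  | inr i, inl false => is_row S (v i)
  | inr i, inl true => is_row S (2 *: v i) && ~~ is_row S (v i)
  | _, _ => false
  end.

Definition H_equiv (S : submat) : rel Hset :=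
  connect [rel x y | H_rule S x y || H_rule S y x].

Definition H_classes (S : submat) : {set {set Hset}} :=
  equivalence_partition (H_equiv S) [set: Hset].

(* The truncated subtractions are harmless: there are at least two classes
   when the class of 1/2 is a singleton, and at least one otherwise. *)
Definition s_ (S : submat) : nat :=
  if #|[set y | H_equiv S (inl true) y]| == 1%N
  then (2 * #|H_classes S| - 3)%N else (2 * #|H_classes S| - 2)%N.

Definition sigma_vec (sg : signed_perm3) (i : 'I_3) : option 'rV[int]_2 :=
  if sg.1 i == i then if sg.2 i then Some (2 *: v i) else None
  else Some (if sg.2 i then v i + v (sg.1 i) else v i - v (sg.1 i)).

Definition S_of (sg : signed_perm3) : submat :=
  [set r | [exists i : 'I_3, (i < 2)%N &&
     (if sigma_vec sg i is Some x then (row r P == x) || (row r P == - x)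
      else false)]].

(* Main.v *)
From HB Require Import structures.
Require Import Defs.
From mathcomp Require Import all_boot all_order all_fingroup all_algebra.
From mathcomp Require Import all_field.
From mathcomp Require Import boolp classical_sets functions cardinality reals.
From mathcomp Require Import sequences exp trigo.
From mathcomp Require Import complex ring lra zify.
Import Order.TTheory GRing.Theory Num.Theory.
Set Implicit Arguments.
Unset Strict Implicit.
Unset Printing Implicit Defensive.
Local Open Scope ring_scope.

(** The complex octonions are the scalars plus a 7-dimensional space of
    imaginary octonions, on which the product splits into a symmetric bilinear
    form bil and a cross product crs; G2 is the group of the matrices preserving
    both (G2P).  The identities between bil and crs that the proof needs follow
    from y (y z) = (y y) z and from the skew-symmetry of crs for bil.

    Every element A of finite order of G2 is conjugate to an element of the
    torus (finite_order_toral).  First, A fixes an imaginary octonion c with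
    bil c c = 1: averaging over the powers of A shows that its fixed space is
    nondegenerate, and this space is not zero because two eigenvectors with
    inverse eigenvalues that are not orthogonal have a fixed, hence zero, cross
    product, which leaves -1 as the only possible eigenvalue.  Next, G2 is
    transitive on such octonions c, by conjugations by suitable octonions, so A
    may be assumed to fix a standard one.  Then A preserves the eigenspaces of
    the cross product with it, two dual 3-spaces, and an element of SL3
    diagonalizes A on one of them, hence everywhere.

    An element of the torus is given by three numbers of product 1, and its
    eigenvalues are 1, these three numbers and their inverses.  This multiset
    determines the triple up to permutations and global inversion
    (spectrum_fused), and these are induced by elements of the normalizer of the
    torus.  Hence the classes to be counted correspond to the orbits of the Weyl
    group on the points of order dividing m of the torus with s distinct
    eigenvalues (card_G2_classes), and their number is the average of the
    numbers of fixed points.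

    A matrix that normalizes the torus links each eigenvalue of an element of
    the torus to one of its conjugate, through its nonzero entries
    (normalizer_signed_perm); this yields the signed permutation sigma and
    identifies the fixed points of w with the points killed by the rows of
    S_of (sigma q w).  The set of all the rows killing a point belongs to Mposet
    and records which eigenvalues of the point are 1, -1, equal or inverse to
    each other, so it determines their number, which is s_
    (distinct_eigenvalues_torus).  Sorting the fixed points by this set gives
    the first formula.  The second is Moebius inversion; since mu is defined by
    recursion on its second argument while the sum runs over the first, it uses
    that a one-sided inverse of a square matrix is two-sided. *)

(** * The cross product on the imaginary octonions *)

Definition co (F : numClosedFieldType) (y : 'cV[F]_7) (k : nat) : F :=
  y (inord k) 0.

Definition vec (F : numClosedFieldType) (s : seq F) : 'cV[F]_7 :=
  \col_i nth 0 s i.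

(** The scalar part of the product of two imaginary octonions. *)
HB.lock Definition bil (F : numClosedFieldType) (y z : 'cV[F]_7) : F :=
  co y 3 * co z 3 + (co y 0 * co z 6 + co y 5 * co z 1 + co y 4 * co z 2 +
                     co y 6 * co z 0 + co y 1 * co z 5 + co y 2 * co z 4) / 2.

(** The imaginary part of the product of two imaginary octonions. *)
HB.lock Definition crs (F : numClosedFieldType) (y z : 'cV[F]_7) : 'cV[F]_7 := vec
  [:: co y 3 * co z 0 - co z 3 * co y 0 - (co y 1 * co z 2 - co y 2 * co z 1);
      co z 3 * co y 1 - co y 3 * co z 1 + (co y 4 * co z 0 - co y 0 * co z 4);
      co z 3 * co y 2 - co y 3 * co z 2 + (co y 0 * co z 5 - co y 5 * co z 0);
      (co y 0 * co z 6 + co y 5 * co z 1 + co y 4 * co z 2 -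
       co y 6 * co z 0 - co y 1 * co z 5 - co y 2 * co z 4) / 2;
      co y 3 * co z 4 - co z 3 * co y 4 - (co y 6 * co z 1 - co y 1 * co z 6);
      co y 3 * co z 5 - co z 3 * co y 5 - (co y 2 * co z 6 - co y 6 * co z 2);
      co z 3 * co y 6 - co y 3 * co z 6 + (co y 5 * co z 4 - co y 4 * co z 5)].

Section Coordinates.
Variable F : numClosedFieldType.
Implicit Types (x y z p c : 'cV[F]_7) (A : 'M[F]_7).

Lemma co_inj y z : (forall k, (k < 7)%N -> co y k = co z k) -> y = z.
Proof.
by move=> e; apply/colP=> i; have := e i (ltn_ord i); rewrite /co inord_val.
Qed.

Lemma coP y z : [/\ co y 0 = co z 0, co y 1 = co z 1, co y 2 = co z 2 &
  [/\ co y 3 = co z 3, co y 4 = co z 4, co y 5 = co z 5 & co y 6 = co z 6]] ->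
  y = z.
Proof.
by case=> ? ? ? [? ? ? ?]; apply: co_inj; do 7?case=> //.
Qed.

Lemma co_vec (s : seq F) k : (k < 7)%N -> co (vec s) k = nth 0 s k.
Proof. by move=> k7; rewrite /co mxE inordK. Qed.

Lemma coD y z k : co (y + z) k = co y k + co z k. Proof. by rewrite /co mxE. Qed.
Lemma coN y k : co (- y) k = - co y k. Proof. by rewrite /co mxE. Qed.
Lemma coZ a y k : co (a *: y) k = a * co y k. Proof. by rewrite /co mxE. Qed.
Lemma co0 k : co (0 : 'cV[F]_7) k = 0. Proof. by rewrite /co mxE. Qed.

Lemma vec_co y :
  y = vec [:: co y 0; co y 1; co y 2; co y 3; co y 4; co y 5; co y 6].
Proof. by apply: co_inj; do 7?case=> //; rewrite co_vec. Qed.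

Lemma co_vec7 (a0 a1 a2 a3 a4 a5 a6 : F) (u := vec [:: a0; a1; a2; a3; a4; a5; a6]) :
  (co u 0 = a0) * (co u 1 = a1) * (co u 2 = a2) * (co u 3 = a3) *
  (co u 4 = a4) * (co u 5 = a5) * (co u 6 = a6).
Proof. by do 6?split; rewrite co_vec. Qed.

Lemma vecD (a0 a1 a2 a3 a4 a5 a6 b0 b1 b2 b3 b4 b5 b6 : F) :
  vec [:: a0; a1; a2; a3; a4; a5; a6] + vec [:: b0; b1; b2; b3; b4; b5; b6] =
  vec [:: a0 + b0; a1 + b1; a2 + b2; a3 + b3; a4 + b4; a5 + b5; a6 + b6].
Proof. by apply: coP; rewrite !(coD, co_vec7). Qed.

Lemma vecZ (k : F) (a0 a1 a2 a3 a4 a5 a6 : F) :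
  k *: vec [:: a0; a1; a2; a3; a4; a5; a6] =
  vec [:: k * a0; k * a1; k * a2; k * a3; k * a4; k * a5; k * a6].
Proof. by apply: coP; rewrite !(coZ, co_vec7). Qed.

Lemma vecN (a0 a1 a2 a3 a4 a5 a6 : F) :
  - vec [:: a0; a1; a2; a3; a4; a5; a6] =
  vec [:: - a0; - a1; - a2; - a3; - a4; - a5; - a6].
Proof. by apply: coP; rewrite !(coN, co_vec7). Qed.

Lemma bil_vec (a0 a1 a2 a3 a4 a5 a6 b0 b1 b2 b3 b4 b5 b6 : F) :
  bil (vec [:: a0; a1; a2; a3; a4; a5; a6]) (vec [:: b0; b1; b2; b3; b4; b5; b6]) =
  a3 * b3 + (a0 * b6 + a5 * b1 + a4 * b2 +
                     a6 * b0 + a1 * b5 + a2 * b4) / 2.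
Proof. by rewrite bil.unlock !co_vec7. Qed.

Lemma crs_vec (a0 a1 a2 a3 a4 a5 a6 b0 b1 b2 b3 b4 b5 b6 : F) :
  crs (vec [:: a0; a1; a2; a3; a4; a5; a6]) (vec [:: b0; b1; b2; b3; b4; b5; b6]) = vec
  [:: a3 * b0 - b3 * a0 - (a1 * b2 - a2 * b1);
      b3 * a1 - a3 * b1 + (a4 * b0 - a0 * b4);
      b3 * a2 - a3 * b2 + (a0 * b5 - a5 * b0);
      (a0 * b6 + a5 * b1 + a4 * b2 -
       a6 * b0 - a1 * b5 - a2 * b4) / 2;
      a3 * b4 - b3 * a4 - (a6 * b1 - a1 * b6);
      a3 * b5 - b3 * a5 - (a2 * b6 - a6 * b2);
      b3 * a6 - a3 * b6 + (a5 * b4 - a4 * b5)].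
Proof. by rewrite crs.unlock !co_vec7. Qed.

End Coordinates.

Ltac vec_ring tac := rewrite ?(bil_vec, crs_vec, vecD, vecZ, vecN);
  congr (vec [:: _; _; _; _; _; _; _]); tac.
Ltac vec_lin := apply: co_inj => ? _; rewrite ?(coD, coN, coZ, co0); ring.

Section Identities.
Variable F : numClosedFieldType.
Implicit Types (x y z p c : 'cV[F]_7) (A : 'M[F]_7).

Lemma bilC y z : bil y z = bil z y. Proof. by rewrite bil.unlock; ring. Qed.
Lemma bilDr y z w : bil y (z + w) = bil y z + bil y w.
Proof. by rewrite bil.unlock !coD; ring. Qed.
Lemma bilZr a y z : bil y (a *: z) = a * bil y z.
Proof. by rewrite bil.unlock !coZ; ring. Qed.
Lemma bilNr y z : bil y (- z) = - bil y z.
Proof. by rewrite bil.unlock !coN; ring. Qed.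
Lemma bil0r y : bil y 0 = 0.
Proof. by rewrite -(scale0r 0) bilZr mul0r. Qed.
Lemma bilDl y z w : bil (y + z) w = bil y w + bil z w.
Proof. by rewrite !(bilC _ w) bilDr. Qed.
Lemma bilZl a y z : bil (a *: y) z = a * bil y z.
Proof. by rewrite !(bilC _ z) bilZr. Qed.
Lemma bilNl y z : bil (- y) z = - bil y z.
Proof. by rewrite !(bilC _ z) bilNr. Qed.

Lemma crsC y z : crs y z = - crs z y.
Proof. by rewrite [y]vec_co [z]vec_co; vec_ring ltac:(ring). Qed.
Lemma crsDr y z w : crs y (z + w) = crs y z + crs y w.
Proof. by rewrite [y]vec_co [z]vec_co [w]vec_co; vec_ring ltac:(ring). Qed.
Lemma crsZr a y z : crs y (a *: z) = a *: crs y z.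
Proof. by rewrite [y]vec_co [z]vec_co; vec_ring ltac:(ring). Qed.
Lemma crsNr y z : crs y (- z) = - crs y z.
Proof. by rewrite -!scaleN1r crsZr. Qed.
Lemma crs0r y : crs y 0 = 0.
Proof. by have := crsZr 0 y 0; rewrite !scale0r. Qed.
Lemma crsDl y z w : crs (y + z) w = crs y w + crs z w.
Proof. by rewrite !(crsC _ w) crsDr opprD. Qed.
Lemma crsZl a y z : crs (a *: y) z = a *: crs y z.
Proof. by rewrite !(crsC _ z) crsZr scalerN. Qed.
Lemma crsNl y z : crs (- y) z = - crs y z.
Proof. by rewrite -!scaleN1r crsZl. Qed.
Lemma crs_id y : crs y y = 0.
Proof.
have /eqP := crsC y y; rewrite -subr_eq0 opprK -mulr2n -scaler_nat scaler_eq0.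
by rewrite pnatr_eq0 => /eqP.
Qed.

(** Alternativity of the octonions, y (y z) = (y y) z, in which y y is the
    scalar bil y y.  Polarization turns it into a rule exchanging y and z in
    y (z w), which gives the identities of higher degree below. *)
Lemma crs_crs y z : crs y (crs y z) = bil y y *: z - bil y z *: y.
Proof. by rewrite [y]vec_co [z]vec_co; vec_ring ltac:(field). Qed.

Lemma bil_crs p y z : bil (crs p y) z = - bil y (crs p z).
Proof. by rewrite [p]vec_co [y]vec_co [z]vec_co !crs_vec !bil_vec; field. Qed.

Lemma crs_crs_polar y z w : crs y (crs z w) + crs z (crs y w) =
  (2 * bil y z) *: w - bil y w *: z - bil z w *: y.
Proof.
have := crs_crs (y + z) w.
rewrite !(crsDl, crsDr) !crs_crs !(bilDl, bilDr) (bilC z y) !scalerDl !scalerDr.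
move=> e; apply: co_inj => k _; have /= := congr1 (fun u => co u k) e.
rewrite !(coD, coN, coZ) => /eqP; rewrite -subr_eq0 => /eqP ek.
apply/eqP; rewrite -subr_eq0 -ek; apply/eqP; ring.
Qed.

Lemma crs_crsE y z w : crs y (crs z w) =
  (2 * bil y z) *: w - bil y w *: z - bil z w *: y - crs z (crs y w).
Proof. by rewrite -crs_crs_polar addrK. Qed.

Lemma bil_crs0 p y : bil p (crs p y) = 0.
Proof. by apply/eqP; rewrite -oppr_eq0 -bil_crs crs_id bilC bil0r. Qed.

(** The part of degree one in p of the compatibility of oct_conj p with the
    cross product. *)
Lemma crs_deriv p y z :
  2 *: crs p (crs y z) = - crs y (crs p z) - crs (crs p y) z
     + 3 *: (bil p y *: z - bil p z *: y).
Proof.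
rewrite (crsC (crs p y)) (crs_crsE y) (crs_crsE z p) (crsC z y) crsNr.
by rewrite (bilC y p) (bilC z p) (bilC z y); vec_lin.
Qed.

(** The part of degree two in p of the compatibility of oct_conj p with the
    cross product. *)
Lemma crs_crs_crs p y z :
  crs (crs p y) (crs p z) = bil p p *: crs y z - (2 * bil p (crs y z)) *: p
     - bil p z *: crs y p - bil p y *: crs p z.
Proof.
have triple : bil (crs p z) y = - bil p (crs y z).
  by rewrite bil_crs (bilC p) bil_crs (crsC p) bilNr.
rewrite (crsC (crs p y)) (crs_crsE (crs p z) p y) (crsC (crs p z) y).
rewrite (crs_crsE y p z) triple (bilC (crs p z)) bil_crs0 (bilC y p).
rewrite !(crsNr, crsDr, crsZr) crs_crs crs_id (crsC y p); vec_lin.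
Qed.

End Identities.

(** * Automorphisms *)

Section Automorphisms.
Variable F : numClosedFieldType.
Implicit Types (x y z p c : 'cV[F]_7) (A B : 'M[F]_7).

Definition mx_of_linear n k (f : 'cV[F]_n -> 'cV[F]_k) : 'M[F]_(k, n) :=
  \matrix_(i, j) f (delta_mx j 0) i 0.

Lemma mx_of_linearE n k (f : 'cV[F]_n -> 'cV[F]_k) (v : 'cV[F]_n) :
  (forall a v w, f (a *: v + w) = a *: f v + f w) -> mx_of_linear f *m v = f v.
Proof.
move=> lin.
have f0 : f 0 = 0.
  have := lin 1 0 0; rewrite scaler0 addr0 scale1r => /eqP.
  by rewrite -subr_eq0 opprD addrA subrr sub0r oppr_eq0 => /eqP.
have fD u w : f (u + w) = f u + f w by have := lin 1 u w; rewrite !scale1r.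
have fZ a u : f (a *: u) = a *: f u by have := lin a u 0; rewrite f0 !addr0.
rewrite [in RHS](matrix_sum_delta v) (big_morph f fD f0).
apply/colP=> i; rewrite summxE mxE; apply: eq_bigr => j _.
by rewrite big_ord1 fZ !mxE mulrC.
Qed.

Lemma mulmx_colP n k (A B : 'M[F]_(k, n)) :
  (forall v : 'cV[F]_n, A *m v = B *m v) -> A = B.
Proof.
move=> e; apply/matrixP=> i j.
have := congr1 (fun u : 'cV_k => u i 0) (e (delta_mx j 0)).
by rewrite -!colE !mxE.
Qed.

Lemma bil_nondegenerate u : u != 0 -> exists y, bil u y != 0.
Proof.
pose E : seq 'cV[F]_7 := [:: vec [:: 1; 0; 0; 0; 0; 0; 0];
  vec [:: 0; 1; 0; 0; 0; 0; 0]; vec [:: 0; 0; 1; 0; 0; 0; 0];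
  vec [:: 0; 0; 0; 1; 0; 0; 0]; vec [:: 0; 0; 0; 0; 1; 0; 0];
  vec [:: 0; 0; 0; 0; 0; 1; 0]; vec [:: 0; 0; 0; 0; 0; 0; 1]].
move=> u0; have [|/allPn[y _ yP]] := boolP (all (fun y => bil u y == 0) E).
  rewrite (vec_co u) /= !bil_vec !(mulr0, mulr1, add0r, addr0).
  have half0 (a : F) : (a / 2 == 0) = (a == 0).
    by rewrite mulf_eq0 invr_eq0 pnatr_eq0 orbF.
  rewrite !mul0r !(addr0, add0r) !half0.
  case/andP=> /eqP e6 /andP[/eqP e5 /andP[/eqP e4 /andP[/eqP e3]]].
  case/andP=> /eqP e2 /andP[/eqP e1 /andP[/eqP e0 _]].
  case/eqP: u0; rewrite (vec_co u) e0 e1 e2 e3 e4 e5 e6.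
  by rewrite -(scale0r 0) -[RHS]/(0 *: _) (vec_co 0) vecZ !co0 !mul0r.
by exists y.
Qed.

Definition bil_preserving A := forall y z, bil (A *m y) (A *m z) = bil y z.
Definition crs_preserving A :=
  forall y z, A *m crs y z = crs (A *m y) (A *m z).

(** The group G2 without octonions; see G2P. *)
Definition g2 A := [/\ A \in unitmx, bil_preserving A & crs_preserving A].

Lemma g2_1 : g2 1%:M.
Proof. by split=> [|y z|y z]; rewrite ?unitmx1 // !mul1mx. Qed.

Lemma g2M A B : g2 A -> g2 B -> g2 (A *m B).
Proof.
case=> uA bA cA [uB bB cB]; split=> [|y z|y z]; first by rewrite unitmx_mul uA.
  by rewrite -!mulmxA bA bB.
by rewrite -!mulmxA cB cA.
Qed.

Lemma g2V A : g2 A -> g2 (invmx A).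
Proof.
case=> uA bA cA; split=> [|y z|y z]; first by rewrite unitmx_inv.
  by rewrite -bA !(mulKVmx uA).
by apply: (can_inj (mulKmx uA)); rewrite cA !(mulKVmx uA).
Qed.

(** A vector killed by an isometry is orthogonal to everything. *)
Lemma bil_preserving_unit A : bil_preserving A -> A \in unitmx.
Proof.
move=> bA; rewrite -unitmx_tr -row_free_unit; apply: inj_row_free => v.
move/(congr1 trmx); rewrite trmx_mul trmxK trmx0 => Av.
apply/trmx_inj; rewrite trmx0; have [//|/bil_nondegenerate[y]] := eqVneq v^T 0.
by rewrite -bA Av bilC bil0r eqxx.
Qed.

Lemma g2_of_preserving A : bil_preserving A -> crs_preserving A -> g2 A.
Proof. by move=> bA; split=> //; apply: bil_preserving_unit. Qed.

(** * Monomial automorphisms *)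

(** These three maps normalize the torus.  On the triples of product 1 that
    parametrize it they induce inversion, a 3-cycle and a transposition.  The
    signs in the last one give it determinant 1 on the span of the first, fifth
    and sixth basis vectors, as for all elements of G2 preserving this space. *)
Definition weyl_inv_fun y := vec
  [:: - co y 6; - co y 5; - co y 4; - co y 3; - co y 2; - co y 1; - co y 0].
Definition weyl_inv := mx_of_linear weyl_inv_fun.
Definition weyl_cycle_fun y := vec
  [:: co y 5; co y 2; co y 6; co y 3; co y 0; co y 4; co y 1].
Definition weyl_cycle := mx_of_linear weyl_cycle_fun.
Definition weyl_swap_fun y := vec
  [:: co y 5; co y 6; - co y 2; co y 3; - co y 4; co y 0; co y 1].
Definition weyl_swap := mx_of_linear weyl_swap_fun.

Lemma weyl_invE y : weyl_inv *m y = weyl_inv_fun y.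
Proof.
apply: mx_of_linearE => a u w.
by rewrite /weyl_inv_fun !coD !coZ; vec_ring ltac:(ring).
Qed.
Lemma weyl_cycleE y : weyl_cycle *m y = weyl_cycle_fun y.
Proof.
apply: mx_of_linearE => a u w.
by rewrite /weyl_cycle_fun !coD !coZ; vec_ring ltac:(ring).
Qed.
Lemma weyl_swapE y : weyl_swap *m y = weyl_swap_fun y.
Proof.
apply: mx_of_linearE => a u w.
by rewrite /weyl_swap_fun !coD !coZ; vec_ring ltac:(ring).
Qed.

Lemma weyl_invK : weyl_inv *m weyl_inv = 1%:M.
Proof.
apply: mulmx_colP => y; rewrite -mulmxA !weyl_invE mul1mx.
by rewrite [in RHS](vec_co y) /weyl_inv_fun !co_vec7; vec_ring ltac:(ring).
Qed.

Lemma g2_weyl_inv : g2 weyl_inv.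
Proof.
apply: g2_of_preserving => y z; rewrite !weyl_invE (vec_co y) (vec_co z).
  by rewrite /weyl_inv_fun !co_vec7 !bil_vec; ring.
by rewrite /weyl_inv_fun crs_vec !co_vec7; vec_ring ltac:(ring).
Qed.
Lemma g2_weyl_swap : g2 weyl_swap.
Proof.
apply: g2_of_preserving => y z; rewrite !weyl_swapE (vec_co y) (vec_co z).
  by rewrite /weyl_swap_fun !co_vec7 !bil_vec; ring.
by rewrite /weyl_swap_fun crs_vec !co_vec7; vec_ring ltac:(ring).
Qed.
Lemma g2_weyl_cycle : g2 weyl_cycle.
Proof.
apply: g2_of_preserving => y z; rewrite !weyl_cycleE (vec_co y) (vec_co z).
  by rewrite /weyl_cycle_fun !co_vec7 !bil_vec; ring.
by rewrite /weyl_cycle_fun crs_vec !co_vec7; vec_ring ltac:(ring).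
Qed.

(** * Transitivity on imaginary units *)

(** Conjugation by the octonion 1 + p, whose norm is 1 - bil p p.  Conjugation
    by an octonion is an automorphism when its cube is a scalar, and for 1 + p
    this happens when bil p p = -3; the norm is then 4, which the factor 1/2
    takes into account. *)
Definition oct_conj_fun p y := 2^-1 *: (crs p y - y - bil p y *: p).
Definition oct_conj p := mx_of_linear (oct_conj_fun p).

Lemma oct_conjE p y : oct_conj p *m y = oct_conj_fun p y.
Proof.
apply: mx_of_linearE => a u w; rewrite /oct_conj_fun crsDr crsZr bilDr bilZr.
by vec_lin.
Qed.

Lemma g2_oct_conj p : bil p p = - 3 -> g2 (oct_conj p).
Proof.
move=> bp; apply: g2_of_preserving => y z.
  rewrite !oct_conjE /oct_conj_fun.
  rewrite !(bilZl, bilZr, bilDl, bilDr, bilNl, bilNr).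
  rewrite !(bil_crs p _ (crs _ _)) crs_crs !(bilDr, bilNr, bilZr) bp.
  rewrite ?bil_crs ?(bilC (crs p y) p) ?bil_crs0 crs_id bil0r.
  by rewrite !(bilC _ p); field.
have := crs_deriv p y z; have := crs_crs_crs p y z; rewrite bp => e2 e1.
rewrite !oct_conjE /oct_conj_fun.
rewrite !(crsZl, crsZr, crsDl, crsDr, crsNl, crsNr, crs_id) e2 !crs_crs.
have {}e1 : crs p (crs y z) = 2^-1 *: (- crs y (crs p z) - crs (crs p y) z
     + 3 *: (bil p y *: z - bil p z *: y)).
  by rewrite -e1 scalerA mulVf ?scale1r ?pnatr_eq0.
rewrite e1 (crsC (crs p y) p) crs_crs bp.
by apply: co_inj => k _; rewrite ?(coD, coN, coZ, co0); field.
Qed.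

Definition im_unit : 'cV[F]_7 := vec [:: 0; 0; 0; 1; 0; 0; 0].

Lemma bil_im_unit : bil im_unit im_unit = 1.
Proof. by rewrite bil_vec; ring. Qed.

Lemma weyl_inv_im_unit : weyl_inv *m im_unit = - im_unit.
Proof. by rewrite weyl_invE /weyl_inv_fun !co_vec7; vec_ring ltac:(ring). Qed.

(** In the quaternion algebra generated by c and u = im_unit, the element c + u
    conjugates u to c, as c c = u u = 1, and so does (a + c) (c + u) for
    every scalar a.  The value of a below makes the cube of this octonion a
    scalar; its scalar part is 1 + k, and p is its imaginary part divided by
    1 + k. *)
Lemma imaginary_unit_transitive_generic c :
  bil c c = 1 -> bil c im_unit != -1 -> exists2 g, g2 g & g *m im_unit = c.
Proof.
move=> cc; set u := im_unit; set k := bil c u => kN1.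
have k1 : 1 + k != 0 by rewrite addrC -[1]opprK subr_eq0.
have uu : bil u u = 1 := bil_im_unit.
pose a := sqrtC (- (1 + 2 * k)).
have aa : a * a = - (1 + 2 * k) by rewrite -expr2 sqrtCK.
pose p := (1 + k)^-1 *: (a *: (c + u) + crs c u).
have cuc : bil (crs c u) c = 0 by rewrite bilC bil_crs0.
have cuu : bil (crs c u) u = 0 by rewrite crsC bilNl bilC bil_crs0 oppr0.
have ncu : bil (crs c u) (crs c u) = k * k - 1.
  by rewrite bil_crs crs_crs cc bilDr bilNr !bilZr uu (bilC u c) -/k; ring.
have pp : bil p p = - 3.
  rewrite !(bilZl, bilZr, bilDl, bilDr) (bilC c (crs c u)) (bilC u (crs c u)).
  rewrite cuc cuu ncu cc uu (bilC u c) -/k.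
  by field: aa.
exists (oct_conj p); first exact: g2_oct_conj.
have pu : bil p u = a by rewrite bilZl !bilDl bilZl bilDl uu cuu -/k; field.
have cpu : crs p u = (1 + k)^-1 *: (a *: crs c u + (c - k *: u)).
  rewrite /p crsZl !crsDl crsZl crsDl crs_id (crsC (crs c u)) (crsC c u).
  by rewrite crsNr crs_crs uu (bilC u) -/k; vec_lin.
rewrite oct_conjE /oct_conj_fun pu cpu /p.
apply: co_inj => j _; rewrite ?(coD, coN, coZ, co0).
move: (co c j) (co u j) (co (crs c u) j) => cj uj wj.
by field: aa.
Qed.

(** The conjugation above exists unless bil c im_unit = -1, and weyl_inv changes
    the sign of this value. *)
Lemma imaginary_unit_transitive c :
  bil c c = 1 -> exists2 g, g2 g & g *m im_unit = c.
Proof.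
move=> cc; have [k|] := eqVneq (bil c im_unit) (-1); last first.
  exact: imaginary_unit_transitive_generic.
have [_ binv _] := g2_weyl_inv.
have [||g gG ge] := @imaginary_unit_transitive_generic (weyl_inv *m c).
- by rewrite binv.
- rewrite -[im_unit]opprK -weyl_inv_im_unit bilNr binv k opprK.
  by rewrite -subr_eq0 opprK -mulr2n pnatr_eq0.
exists (weyl_inv *m g); first exact: g2M g2_weyl_inv gG.
by rewrite -mulmxA ge mulmxA weyl_invK mul1mx.
Qed.

End Automorphisms.

(** * Elements of finite order *)

Section FiniteOrder.
Variable F : numClosedFieldType.

(** The minimal polynomial divides X^m - 1, whose roots are simple. *)
Lemma finite_order_diagonalizable n m (A : 'M[F]_n.+1) :
  (0 < m)%N -> A ^+ m = 1 ->
  exists Q d, Q \in unitmx /\ A = Q *m diag_mx d *m invmx Q.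
Proof.
move=> m0 Am.
have [rs Ers] := closed_field_poly_normal ('X^m - 1 : {poly F}).
rewrite (monicP (monic_Xn_sub_1 F m0)) scale1r in Ers.
have /diagonalizableP[Q Qu /diagonalizable_forPex[d /(simmxRL Qu) e]] :
    exists2 rs, uniq rs & mxminpoly A %| \prod_(x <- rs) ('X - x%:P).
  exists rs.
    rewrite -separable_prod_XsubC -Ers separable_Xn_sub_1 //.
    by rewrite pnatr_eq0 -lt0n.
  apply: mxminpoly_min.
  by rewrite -Ers rmorphB rmorphXn /= horner_mx_X rmorph1 Am subrr.
exists (invmx Q), d; rewrite unitmx_inv invmxK; split=> //.
by rewrite e !mulmxA mulVmx // mul1mx -mulmxA mulVmx // mulmx1.
Qed.

Implicit Types (y z u : 'cV[F]_7).

Variables (m : nat) (A : 'M[F]_7).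
Hypotheses (m0 : (0 < m)%N) (gA : g2 A) (Am : A ^+ m = 1).

(** Up to the factor m, the projection onto the eigenspace of 1 / a. *)
Definition spectral_sum (a : F) y := \sum_(j < m) a ^+ j *: (A ^+ j *m y).

Lemma spectral_sum_eigen a y : a ^+ m = 1 ->
  a *: (A *m spectral_sum a y) = spectral_sum a y.
Proof.
move=> am; rewrite /spectral_sum; case: m m0 Am am => // n _ An an.
rewrite mulmx_sumr scaler_sumr big_ord_recr big_ord_recl addrC /=.
rewrite -scalemxAr scalerA mulmxA -!exprS.
rewrite -[A *m _]/(A * A ^+ n) -exprS An an; congr (_ + _).
apply: eq_bigr => j _; rewrite /bump add1n -scalemxAr scalerA -exprS.
by rewrite mulmxA -[A *m A ^+ j]/(A * A ^+ j) -exprS.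
Qed.

(** All the terms of the sum have the same pairing with u, since A is an
    isometry. *)
Lemma bil_spectral_sum a u y : A *m u = a *: u ->
  bil u (spectral_sum a y) = m%:R * bil u y.
Proof.
move=> Au; have [_ bA _] := gA.
have term j : bil u (a ^+ j *: (A ^+ j *m y)) = bil u y.
  elim: j => [|j IHj]; first by rewrite !expr0 scale1r mul1mx.
  by rewrite -{}IHj !bilZr exprSr -mulrA -bilZl -Au exprS -mulmxA bA.
rewrite /spectral_sum (big_morph (bil u) (bilDr u) (bil0r u)).
by rewrite (eq_bigr (fun=> bil u y)) // sumr_const card_ord mulr_natl.
Qed.

Lemma eigenvalue_root a u : u != 0 -> A *m u = a *: u -> a ^+ m = 1.
Proof.
move=> u0 Au; have Aj j : A ^+ j *m u = a ^+ j *: u.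
  elim: j => [|j IHj]; first by rewrite !expr0 scale1r mul1mx.
  by rewrite exprS -mulmxA IHj -scalemxAr Au scalerA -exprSr.
have /eqP := Aj m; rewrite Am mul1mx -[X in X == _]scale1r -subr_eq0 -scalerBl.
by rewrite scaler_eq0 (negPf u0) orbF subr_eq0 => /eqP.
Qed.

(** Pair an eigenvector u for a with an eigenvector y for 1 / a such that
    u, y are not orthogonal.  Their cross product is fixed, so it vanishes
    when there are no fixed vectors, and the double cross product formula then
    says that bil u u *: y = bil u y *: u.  Hence u is not isotropic, so a is 1
    or -1 because A is an isometry, and 1 is excluded. *)
Lemma eigenvalue_without_fixed_vector a u :
  (forall z, A *m z = z -> z = 0) -> u != 0 -> A *m u = a *: u -> a = -1.
Proof.
move=> nofix u0 Au; have [_ bA cA] := gA; have am := eigenvalue_root u0 Au.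
have a0 : a != 0.
  by apply/eqP=> a0; move/eqP: am; rewrite a0 expr0n gtn_eqF // eq_sym oner_eq0.
have [y0 uy0] := bil_nondegenerate u0.
set y := spectral_sum a y0.
have uy : bil u y != 0.
  by rewrite bil_spectral_sum // mulf_neq0 // pnatr_eq0 -lt0n.
have Ay : a *: (A *m y) = y by exact: spectral_sum_eigen.
have uxy : crs u y = 0 by apply: nofix; rewrite cA Au crsZl -crsZr Ay.
have /eqP := crs_crs u y; rewrite uxy crs0r eq_sym subr_eq0 => /eqP e.
have [a2|a2] := eqVneq (a ^+ 2) 1; last first.
  have uu : bil u u = 0.
    have /eqP := bA u u; rewrite Au bilZl bilZr mulrA -expr2 -subr_eq0.
    rewrite -{2}[bil u u]mul1r -mulrBl mulf_eq0 subr_eq0 (negPf a2) /=.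
    by move/eqP.
  move/eqP: e; rewrite uu scale0r eq_sym scaler_eq0 (negPf uy) (negPf u0).
  by [].
move/eqP: a2; rewrite sqrf_eq1 => /orP[/eqP a1|/eqP //].
by move: u0; rewrite (nofix u) ?eqxx // Au a1 scale1r.
Qed.

(** Without fixed vectors A would be -1, which does not preserve the cross
    product. *)
Lemma exists_fixed_vector : exists2 c : 'cV[F]_7, c != 0 & A *m c = c.
Proof.
have [Q [d [Qu AQ]]] := @finite_order_diagonalizable 6 m A m0 Am.
have AQd : A *m Q = Q *m diag_mx d by rewrite AQ mulmxKV.
have Qd i : A *m col i Q = d 0 i *: col i Q.
  transitivity (col i (A *m Q)); first by rewrite !colE mulmxA.
  by rewrite AQd mul_mx_diag; apply/colP=> k; rewrite !mxE mulrC.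
have Q0 i : col i Q != 0.
  apply/eqP=> Qi0; have : delta_mx i 0 = 0 :> 'cV[F]_7.
    by rewrite -(mulKmx Qu (delta_mx i 0)) -colE Qi0 mulmx0.
  by move/colP/(_ i)/eqP; rewrite !mxE !eqxx oner_eq0.
have [i /eqP di|nod] := pickP (fun i => d 0 i == 1).
  by exists (col i Q); rewrite // Qd di scale1r.
have nofix z : A *m z = z -> z = 0.
  move=> Az; rewrite -(mulKVmx Qu z).
  set w := invmx Q *m z; suff -> : w = 0 by rewrite mulmx0.
  have : diag_mx d *m w = w.
    by rewrite /w -[in RHS]Az AQ !mulmxA mulVmx // mul1mx.
  rewrite mul_diag_mx; move: w => w /colP dw; apply/colP=> k; have := dw k.
  move/eqP; rewrite !mxE -subr_eq0 -{2}[w k 0]mul1r -mulrBl mulf_eq0 subr_eq0.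
  by rewrite nod => /eqP.
have AN1 : A = -1%:M.
  suff -> : A = Q *m (-1%:M) *m invmx Q by rewrite mulmxN mulNmx mulmx1 mulmxV.
  rewrite {1}AQ; congr (_ *m _ *m _); apply/matrixP=> i j; rewrite !mxE.
  have [_|_] := eqVneq i j; last by rewrite !mulr0n oppr0.
  by rewrite !mulr1n (eigenvalue_without_fixed_vector nofix (Q0 i) (Qd i)).
have [_ _ cA] := gA.
(* The cross product of e0 and e5 is the basis vector of index 2. *)
pose e0 : 'cV[F]_7 := vec [:: 1; 0; 0; 0; 0; 0; 0].
pose e5 : 'cV[F]_7 := vec [:: 0; 0; 0; 0; 0; 1; 0].
have e : crs e0 e5 = 0.
  by apply: nofix; rewrite cA AN1 !mulNmx !mul1mx crsNl crsNr opprK.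
have /eqP := congr1 (fun u => co u 2) e; rewrite crs_vec co_vec7 co0.
by rewrite !(mul0r, mulr0, mul1r, subr0, add0r) oner_eq0.
Qed.

(** The fixed space is nondegenerate: averaging over the powers of A makes any
    vector fixed without changing its pairing with a given fixed vector.  Hence
    it contains an anisotropic vector. *)
Lemma exists_fixed_unit : exists2 c, bil c c = 1 & A *m c = c.
Proof.
have [c c0 Ac] := exists_fixed_vector.
suff [z Az zz] : exists2 z, A *m z = z & bil z z != 0.
  exists ((sqrtC (bil z z))^-1 *: z); last by rewrite -scalemxAr Az.
  rewrite bilZl bilZr mulrA -invfM -expr2 sqrtCK mulVf //.
have [y0 cy0] := bil_nondegenerate c0.
set y := spectral_sum 1 y0.
have Ay : A *m y = y by have := @spectral_sum_eigen 1 y0 (expr1n _ _); rewrite scale1r.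
have cy : bil c y != 0.
  by rewrite bil_spectral_sum ?scale1r // mulf_neq0 // pnatr_eq0 -lt0n.
have [cc|] := eqVneq (bil c c) 0; last by exists c.
have [yy|] := eqVneq (bil y y) 0; last by exists y.
exists (c + y); first by rewrite mulmxDr Ac Ay.
rewrite !(bilDl, bilDr) cc yy add0r addr0 (bilC y) -mulr2n -mulr_natl.
by rewrite mulf_neq0 // pnatr_eq0.
Qed.

End FiniteOrder.

(** * The subgroup SL3 *)

Section Diagonalization.
Variable F : numClosedFieldType.
Implicit Types (y z u : 'cV[F]_7) (G : 'M[F]_3) (w : 'cV[F]_3).

Definition en G (i j : nat) : F := G (inord i) (inord j).

Lemma inord3 (i : 'I_3) : [\/ i = inord 0, i = inord 1 | i = inord 2].
Proof.
case: i => -[|[|[|//]]] i3; [constructor 1|constructor 2|constructor 3];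
  by apply: val_inj; rewrite /= inordK.
Qed.

Lemma sum3 (f : 'I_3 -> F) : \sum_i f i = f (inord 0) + f (inord 1) + f (inord 2).
Proof.
rewrite !big_ord_recl big_ord0 addr0 addrA.
by congr (f _ + f _ + f _); apply: val_inj; rewrite /= ?inordK.
Qed.

Definition det3 G : F :=
  en G 0 0 * (en G 1 1 * en G 2 2 - en G 1 2 * en G 2 1)
  - en G 0 1 * (en G 1 0 * en G 2 2 - en G 1 2 * en G 2 0)
  + en G 0 2 * (en G 1 0 * en G 2 1 - en G 1 1 * en G 2 0).

Lemma det3E G : \det G = det3 G.
Proof.
have enE i j : G i j = en G i j by rewrite /en !inord_val.
rewrite (expand_det_row _ ord0) !big_ord_recl big_ord0 /cofactor.
rewrite !(expand_det_row _ (ord0 : 'I_2)) !big_ord_recl !big_ord0 /cofactor.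
rewrite !det_mx11 !mxE !enE /det3 /= /bump /= !addn0 !add0n !addn1.
rewrite ?expr0 ?expr1 ?sqrrN ?expr1n; ring.
Qed.

Definition minor3 G (i j k l : nat) : F :=
  en G i k * en G j l - en G i l * en G j k.

(** SL3 acts by G on the space embed3 below, and by the inverse transpose of G,
    that is by its cofactors, on the dual isotropic space. *)
Definition sl3_fun G y := vec
  [:: en G 0 0 * co y 0 + en G 0 1 * co y 5 + en G 0 2 * co y 4;
    minor3 G 2 0 1 2 * co y 6 + minor3 G 2 0 2 0 * co y 1 + minor3 G 2 0 0 1 * co y 2;
    minor3 G 0 1 1 2 * co y 6 + minor3 G 0 1 2 0 * co y 1 + minor3 G 0 1 0 1 * co y 2;
    co y 3;
    en G 2 0 * co y 0 + en G 2 1 * co y 5 + en G 2 2 * co y 4;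
    en G 1 0 * co y 0 + en G 1 1 * co y 5 + en G 1 2 * co y 4;
    minor3 G 1 2 1 2 * co y 6 + minor3 G 1 2 2 0 * co y 1 + minor3 G 1 2 0 1 * co y 2].

Definition sl3_mx G := mx_of_linear (sl3_fun G).

Lemma sl3_mxE G y : sl3_mx G *m y = sl3_fun G y.
Proof.
apply: mx_of_linearE => a u w.
by rewrite /sl3_fun !coD !coZ; vec_ring ltac:(ring).
Qed.

Lemma g2_sl3_mx G : \det G = 1 -> g2 (sl3_mx G).
Proof.
rewrite det3E /det3 => dG.
have dG' : en G 0 0 * en G 1 1 * en G 2 2 = 1 + en G 0 0 * en G 1 2 * en G 2 1
  + en G 0 1 * (en G 1 0 * en G 2 2 - en G 1 2 * en G 2 0)
  - en G 0 2 * (en G 1 0 * en G 2 1 - en G 1 1 * en G 2 0).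
  by rewrite -dG; ring.
apply: g2_of_preserving => y z; rewrite !sl3_mxE (vec_co y) (vec_co z).
  by rewrite /sl3_fun !co_vec7 /minor3 !bil_vec; ring: dG'.
rewrite crs_vec /sl3_fun !co_vec7 /minor3 crs_vec.
by congr (vec [:: _; _; _; _; _; _; _]); ring: dG'.
Qed.

(** The isotropic 3-space spanned by the basis vectors of weights P1, -P2, -P3,
    whose sum is zero; the cross product with im_unit acts on it as 1. *)
Definition embed3 w : 'cV[F]_7 :=
  vec [:: w (inord 0) 0; 0; 0; 0; w (inord 2) 0; w (inord 1) 0; 0].

Lemma embed3_inj : injective embed3.
Proof.
move=> w w' e; apply/colP=> i.
have e0 := congr1 (fun u => co u 0) e; have e4 := congr1 (fun u => co u 4) e.
have e5 := congr1 (fun u => co u 5) e; rewrite !co_vec7 in e0 e4 e5.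
by case: (inord3 i) => ->.
Qed.

Lemma embed3D a w w' : embed3 (a *: w + w') = a *: embed3 w + embed3 w'.
Proof. by rewrite /embed3 !mxE vecZ vecD !mulr0 !addr0. Qed.

Lemma sl3_mx_embed3 G w : sl3_mx G *m embed3 w = embed3 (G *m w).
Proof.
rewrite sl3_mxE /sl3_fun /embed3 !co_vec7 !mxE !sum3 /en !mulr0 !addr0.
by congr (vec [:: _; _; _; _; _; _; _]).
Qed.

(** The numbers x, y, z are the eigenvalues of weights P1, -P2, -P3; their
    product is 1 on the torus. *)
Definition toral (x y z : F) : 'M[F]_7 :=
  diag_mx (\row_j nth 0 [:: x; y^-1; z^-1; 1; z; y; x^-1] j).

Lemma toralE (x y z : F) u : toral x y z *m u = vec [:: x * co u 0; y^-1 * co u 1;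
   z^-1 * co u 2; co u 3; z * co u 4; y * co u 5; x^-1 * co u 6].
Proof.
rewrite {1}(vec_co u) mul_diag_mx; apply/colP=> i; rewrite !mxE.
by case: i => -[|[|[|[|[|[|[|]]]]]]] //= _; rewrite mul1r.
Qed.

(** B commutes with the cross product by im_unit, so it preserves its
    eigenspaces. *)
Lemma fixing_im_unit_embed3 B : g2 B -> B *m im_unit F = im_unit F ->
  exists M : 'M[F]_3, forall w, B *m embed3 w = embed3 (M *m w).
Proof.
case=> uB bB cB Bc.
have eig w : crs (im_unit F) (B *m embed3 w) = B *m embed3 w.
  rewrite -{1}Bc -cB; congr (_ *m _); rewrite /im_unit /embed3 crs_vec.
  by vec_ring ltac:(ring).
pose p (y : 'cV[F]_7) : 'cV[F]_3 := \col_i nth 0 [:: co y 0; co y 5; co y 4] i.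
have pE w : embed3 (p (B *m embed3 w)) = B *m embed3 w.
  move: (eig w); move: (B *m embed3 w) => y; rewrite (vec_co y) /im_unit crs_vec => e.
  have e1 := congr1 (fun u => co u 1) e; have e2 := congr1 (fun u => co u 2) e.
  have e3 := congr1 (fun u => co u 3) e; have e6 := congr1 (fun u => co u 6) e.
  move: e1 e2 e3 e6; rewrite !co_vec7 !(mul0r, mulr0, mul1r, sub0r, subr0, addr0).
  have self0 a : - a = a :> F -> a = 0.
    by move/eqP; rewrite eq_sym -subr_eq0 opprK -mulr2n mulrn_eq0 => /eqP.
  move=> /self0 e1 /self0 e2 e3 /self0 e6; rewrite /embed3 /p !mxE !inordK //= !co_vec7.
  by rewrite e1 e2 -e3 e6.
exists (mx_of_linear (fun w => p (B *m embed3 w))) => w; rewrite mx_of_linearE ?pE //.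
move=> a w1 w2; rewrite embed3D mulmxDr -scalemxAr /p; apply/colP=> i.
rewrite !mxE !(coD, coZ).
by case: (inord3 i) => ->; rewrite inordK.
Qed.

End Diagonalization.

(** * Diagonalization *)

Section Diagonalization.
Variable F : numClosedFieldType.

(** Three cross products of the weight vectors of embed3 give the remaining
    weight vectors, so the automorphism is determined by its eigenvalues on
    embed3. *)
Lemma diagonal_on_embed3 C (d : 'rV[F]_3) : g2 C -> C *m im_unit F = im_unit F ->
  (forall w, C *m embed3 w = embed3 (diag_mx d *m w)) ->
  exists x y z : F, x * y * z = 1 /\ C = toral x y z.
Proof.
case=> uC bC cC Cc Ci.
pose e i : 'cV[F]_7 := embed3 (delta_mx (inord i) 0).
pose x i := d 0 (inord i).
have Ce i : C *m e i = x i *: e i.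
  have -> : x i *: e i = embed3 (x i *: delta_mx (inord i) 0).
    by rewrite /embed3 vecZ !mxE !mulr0.
  rewrite Ci; congr embed3; rewrite mul_diag_mx; apply/colP=> k; rewrite !mxE.
  by case: eqVneq => [->|]; rewrite ?mulr0.
have eE : (e 0 = vec [:: 1; 0; 0; 0; 0; 0; 0]) *
   (e 1 = vec [:: 0; 0; 0; 0; 0; 1; 0]) * (e 2 = vec [:: 0; 0; 0; 0; 1; 0; 0]).
  by do 2?split; rewrite /e /embed3 !mxE -!val_eqE /= !inordK.
have Cf i j : C *m crs (e i) (e j) = (x i * x j) *: crs (e i) (e j).
  by rewrite cC !Ce crsZl crsZr scalerA.
have x012 : x 0%N * x 1%N * x 2%N = 1.
  have := bC (e 0%N) (crs (e 1%N) (e 2%N)).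
  rewrite Ce Cf bilZl bilZr mulrA [x 0%N * _]mulrA -{2}[bil _ _]mul1r.
  apply: mulIf; rewrite !eE crs_vec bil_vec.
  by rewrite !(mulr0, mul0r, subr0, add0r, addr0, mul1r) invr_eq0 pnatr_eq0.
have [x0 x1 x2] : [/\ x 0%N != 0, x 1%N != 0 & x 2%N != 0].
  have := oner_neq0 F; rewrite -x012 !mulf_eq0 !negb_or => /andP[/andP[? ?] ?].
  by split.
exists (x 0%N), (x 1%N), (x 2%N); split=> //.
have inv0 : (x 0%N)^-1 = x 1%N * x 2%N.
  by apply: (mulfI x0); rewrite mulfV // mulrA x012.
have inv1 : (x 1%N)^-1 = x 2%N * x 0%N.
  by apply: (mulfI x1); rewrite mulfV // -x012; ring.
have inv2 : (x 2%N)^-1 = x 0%N * x 1%N.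
  by apply: (mulfI x2); rewrite mulfV // -x012; ring.
apply: mulmx_colP => u; rewrite toralE inv0 inv1 inv2.
have -> : u = co u 0 *: e 0%N + co u 1 *: crs (e 2%N) (e 0%N)
  + co u 2 *: crs (e 0%N) (e 1%N) + co u 3 *: im_unit F + co u 4 *: e 2%N
  + co u 5 *: e 1%N + co u 6 *: crs (e 1%N) (e 2%N).
  by rewrite {1}(vec_co u) !eE !crs_vec /im_unit !(vecZ, vecD); vec_ring ltac:(ring).
rewrite !mulmxDr -!scalemxAr !Ce !Cf Cc !eE !crs_vec /im_unit.
rewrite !(vecZ, vecD) !co_vec7; vec_ring ltac:(ring).
Qed.

Lemma finite_order_fixing_im_unit B m : (0 < m)%N -> B ^+ m = 1 -> g2 B ->
  B *m im_unit F = im_unit F ->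
  exists g (x y z : F), [/\ g2 g, x * y * z = 1 & B = g *m toral x y z *m invmx g].
Proof.
move=> m0 Bm gB Bc; have [M BM] := fixing_im_unit_embed3 gB Bc.
have Mm : M ^+ m = 1.
  apply: mulmx_colP => w; apply: embed3_inj; rewrite mul1mx -[in RHS](mul1mx (embed3 w)).
  rewrite -[1%:M in RHS]Bm; elim: m w {m0 Bm} => [|m IHm] w.
    by rewrite !expr0 !mul1mx.
  by rewrite !exprSr -!mulmxA IHm BM.
have [Q [d [Qu MQ]]] := finite_order_diagonalizable m0 Mm.
(* Rescaling Q to determinant 1 makes it act on the octonions. *)
pose G := 3.-root ((\det Q)^-1) *: Q.
have dG : \det G = 1.
  by rewrite detZ rootCK // mulVf // -unitfE -unitmxE.
have MG : M *m G = G *m diag_mx d.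
  by rewrite -scalemxAr MQ mulmxKV // -scalemxAl.
have gG := g2_sl3_mx dG; have [uG _ _] := gG.
pose C := invmx (sl3_mx G) *m B *m sl3_mx G.
have gC : g2 C by exact: g2M (g2M (g2V gG) gB) gG.
have Gc : sl3_mx G *m im_unit F = im_unit F.
  by rewrite sl3_mxE /sl3_fun !co_vec7 !mulr0 !addr0.
have Cc : C *m im_unit F = im_unit F.
  by rewrite /C -!mulmxA Gc Bc -{1}Gc mulKmx.
have Ci w : C *m embed3 w = embed3 (diag_mx d *m w).
  by rewrite /C -!mulmxA sl3_mx_embed3 BM mulmxA MG -mulmxA -sl3_mx_embed3 mulKmx.
have [x [y [z [xyz Ctor]]]] := diagonal_on_embed3 gC Cc Ci.
exists (sl3_mx G), x, y, z; split=> //.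
by rewrite -Ctor /C !mulmxA mulmxV // mul1mx mulmxK.
Qed.

Lemma conj_expr (g A : 'M[F]_7) m : g \in unitmx ->
  (g *m A *m invmx g) ^+ m = g *m A ^+ m *m invmx g.
Proof.
move=> ug; elim: m => [|m IHm]; first by rewrite !expr0 mulmx1 mulmxV.
rewrite !exprS IHm -[_ * (_ *m invmx g)]/(_ *m (_ *m invmx g)).
by rewrite -[A * A ^+ m]/(A *m A ^+ m) !mulmxA mulmxKV.
Qed.

Lemma conj_expr_eq1 (g A : 'M[F]_7) m : g \in unitmx ->
  (g *m A *m invmx g) ^+ m = 1 -> A ^+ m = 1.
Proof.
move=> ug; rewrite conj_expr // => e; rewrite -(mulKmx ug (A ^+ m)).
by rewrite -[g *m _](mulmxK (_ : invmx g \in unitmx)) ?unitmx_inv // invmxK e mul1mx mulVmx.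
Qed.

(** An element of finite order fixes some c with bil c c = 1, and by transitivity
    c may be taken to be im_unit; the element then preserves embed3, on which
    SL3 diagonalizes it. *)
Lemma finite_order_toral A m : (0 < m)%N -> A ^+ m = 1 -> g2 A ->
  exists g (x y z : F), [/\ g2 g, x * y * z = 1, toral x y z ^+ m = 1 &
    A = g *m toral x y z *m invmx g].
Proof.
move=> m0 Am gA; have [c cc Ac] := exists_fixed_unit m0 gA Am.
have [g gG gc] := imaginary_unit_transitive cc; have [ug _ _] := gG.
pose B := invmx g *m A *m g.
have AE : g *m B *m invmx g = A by rewrite /B !mulmxA mulmxV // mul1mx mulmxK.
have Bm : B ^+ m = 1 by apply: (conj_expr_eq1 ug); rewrite AE.
have Bc : B *m im_unit F = im_unit F.
  by rewrite /B -!mulmxA gc Ac -gc mulKmx.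
have [h [x [y [z [gh xyz BE]]]]] :=
  finite_order_fixing_im_unit m0 Bm (g2M (g2M (g2V gG) gA) gG) Bc.
have [uh _ _] := gh; exists (g *m h), x, y, z; split=> //; first exact: g2M.
  by apply: (conj_expr_eq1 uh); rewrite -BE.
have -> : invmx (g *m h) = invmx h *m invmx g by exact: invrM.
by rewrite -AE BE !mulmxA.
Qed.

Lemma g2_toral (x y z : F) : x * y * z = 1 -> g2 (toral x y z).
Proof.
move=> p; have [x0 y0 z0] : [/\ x != 0, y != 0 & z != 0].
  have := oner_neq0 F; rewrite -p !mulf_eq0 !negb_or => /andP[/andP[]].
  by split.
have xV : x^-1 = y * z by apply: (mulfI x0); rewrite mulfV // mulrA p.
have yV : y^-1 = z * x by apply: (mulfI y0); rewrite mulfV // -p; ring.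
have zV : z^-1 = x * y by apply: (mulfI z0); rewrite mulfV // -p; ring.
apply: g2_of_preserving => u w; rewrite !toralE xV yV zV (vec_co u) (vec_co w).
  by rewrite !co_vec7 !bil_vec; ring: p.
by rewrite crs_vec !co_vec7 crs_vec; congr (vec [:: _; _; _; _; _; _; _]); ring: p.
Qed.

Lemma toral_inj (x y z x' y' z' : F) : toral x y z = toral x' y' z' ->
  [/\ x = x', y = y' & z = z'].
Proof.
have ent (a b c : F) : (toral a b c (inord 0) (inord 0) = a) *
    (toral a b c (inord 5) (inord 5) = b) * (toral a b c (inord 4) (inord 4) = c).
  by rewrite !mxE !eqxx !inordK.
by move=> e; split; [rewrite -(ent x y z).1.1 | rewrite -(ent x y z).1.2 |
  rewrite -(ent x y z).2]; rewrite e ent.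
Qed.

Lemma toral1 : toral 1 1 1 = 1%:M :> 'M[F]_7.
Proof.
by apply: mulmx_colP => u; rewrite toralE invr1 !mul1r -vec_co mul1mx.
Qed.

Lemma toral_comm (x y z x' y' z' : F) :
  toral x y z *m toral x' y' z' = toral x' y' z' *m toral x y z.
Proof.
by rewrite !mulmx_diag; congr diag_mx; apply/rowP=> i; rewrite !mxE mulrC.
Qed.

Lemma toralX (x y z : F) n : toral x y z ^+ n = toral (x ^+ n) (y ^+ n) (z ^+ n).
Proof.
elim: n => [|n IHn]; first by rewrite !expr0 toral1.
rewrite exprS IHn; apply: mulmx_colP => u.
by rewrite -mulmxA !toralE !co_vec7 !mulrA -!invfM -!exprS.
Qed.

End Diagonalization.

(** * The exponential and the roots of unity *)

Section Exponential.
Variable R : realType.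
Local Notation C := (complex R).

Lemma e2piD (z w : C) : e2pi (z + w) = e2pi z * e2pi w.
Proof.
case: z w => [a b] [c d]; rewrite /e2pi /=.
rewrite !mulrDr opprD expRD cosD sinD.
by simpc; congr Complex; ring.
Qed.

Lemma e2pi0 : e2pi (0 : C) = 1.
Proof. by rewrite /e2pi /= !mulr0 oppr0 expR0 cos0 sin0; simpc. Qed.

Lemma e2piN (z : C) : e2pi (- z) = (e2pi z)^-1.
Proof.
have h : e2pi z * e2pi (- z) = 1 by rewrite -e2piD subrr e2pi0.
have z0 : e2pi z != 0.
  by apply/eqP=> z0; move/eqP: h; rewrite z0 mul0r eq_sym oner_eq0.
by rewrite -[RHS]mulr1 -h mulKf.
Qed.

Lemma e2pi_neq0 (z : C) : e2pi z != 0.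
Proof.
apply/eqP=> z0; have := e2piD z (- z).
by rewrite subrr e2pi0 z0 mul0r => /eqP; rewrite oner_eq0.
Qed.

Lemma e2pi_real (r : R) :
  e2pi (r%:C)%C = Complex (cos (2 * pi * r)) (sin (2 * pi * r)).
Proof. by rewrite /e2pi /= mulr0 oppr0 expR0 mul1r. Qed.

Lemma e2piMz (z : C) (n : int) : e2pi (n%:~R * z) = e2pi z ^ n.
Proof.
have nat k : e2pi (k%:R * z) = e2pi z ^+ k.
  elim: k => [|k IHk]; first by rewrite mul0r e2pi0 expr0.
  by rewrite -natr1 mulrDl mul1r e2piD IHk exprSr.
case: n => k; first exact: nat.
by rewrite NegzE mulrNz mulNr e2piN nat exprnN.
Qed.

(** Reducing the angle to (0, pi], where the cosine is injective, settles when
    a rational multiple of the full turn is trivial. *)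
Lemma cos_turn_lt1 (r : R) : 0 < r < 1 -> cos (2 * pi * r) != 1.
Proof.
have pi0 := pi_gt0 R.
suff half (t : R) : 0 < t <= 1 / 2 -> cos (2 * pi * t) != 1.
  case/andP=> r0 r1; have [h|h] := leP r (1 / 2); first by rewrite half ?r0.
  have -> : cos (2 * pi * r) = cos (2 * pi * (1 - r)).
    have -> : 2 * pi * r = - (2 * pi * (1 - r)) + pi *+ 2 by ring.
    by rewrite cosD2pi cosN.
  by apply: half; lra.
case/andP=> t0 t1; apply/eqP => e.
have := @cos_inj R (2 * pi * t) 0; rewrite cos0 e !in_itv /= lexx pi_ge0 => h.
have /eqP : 2 * pi * t = 0 by apply: h => //; nra.
by rewrite !mulf_eq0 pnatr_eq0 !gt_eqF.
Qed.

Definition zeta (m : nat) : C := e2pi (m%:R^-1).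

Lemma zetaX m k : zeta m ^+ k = e2pi (k%:R / m%:R).
Proof. by rewrite /zeta exprnP -e2piMz. Qed.

Lemma zeta_prim m : (0 < m)%N -> m.-primitive_root (zeta m).
Proof.
move=> m0; have mR : (m%:R : R) != 0 by rewrite pnatr_eq0 -lt0n.
have mC : (m%:R : C) != 0 by rewrite pnatr_eq0 -lt0n.
rewrite /primitive_root_of_unity m0; apply/forallP=> i.
apply/eqP; rewrite unity_rootE zetaX.
have realE : (i.+1%:R / m%:R : C) = ((i.+1%:R / m%:R : R)%:C)%C.
  by rewrite -[_ / _ : C]/(_ / _) rmorphM fmorphV !rmorph_nat.
rewrite realE e2pi_real; have [->|im] := eqVneq i.+1 m.
  rewrite divff // mulr1 mulr_natl cos2pi sin2pi.
  by apply/eqP.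
apply/negbTE/eqP=> -[h _]; have /eqP := h; apply/negP/cos_turn_lt1.
rewrite divr_gt0 ?ltr0n //= ltr_pdivrMr ?ltr0n // mul1r ltr_nat.
by rewrite ltn_neqAle im ltn_ord.
Qed.

End Exponential.

(** * Automorphisms of the octonions and of the cross product *)

Section Bridge.
Variable R : realType.
Local Notation C := (complex R).
Implicit Types (a b : C) (y z : 'cV[C]_7).

Lemma zorn_eq (F : fieldType) (a a' b b' : F) (u u' v v' : 'cV[F]_3) :
  a = a' -> u = u' -> v = v' -> b = b' -> Defs.Zorn a u v b = Defs.Zorn a' u' v' b'.
Proof. by move=> -> -> -> ->. Qed.

Lemma oct_re_oct a y : oct_re (oct a y) = a.
Proof. by rewrite /oct_re /oct /=; field. Qed.

Lemma oct_im_oct a y : oct_im (oct a y) = y.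
Proof.
rewrite [RHS]vec_co /oct_im /oct /=; apply/colP=> i; rewrite !mxE !inordK //=.
have -> : (a + y (inord 3) 0 - (a - y (inord 3) 0)) / 2 = co y 3.
  by rewrite /co; field.
by [].
Qed.

Lemma octK (z : zorn C) : oct (oct_re z) (oct_im z) = z.
Proof.
case: z => a u v b; rewrite /oct /oct_re /oct_im /= !mxE !inordK //=.
apply: zorn_eq; try by field.
  by apply/colP=> i; rewrite mxE; case: (inord3 i) => ->; rewrite inordK.
by apply/colP=> i; rewrite mxE; case: (inord3 i) => ->; rewrite inordK.
Qed.

Lemma zmul_oct a b y z : zmul (oct a y) (oct b z) =
  oct (a * b + bil y z) (a *: z + b *: y + crs y z).
Proof.
have i1 (k : nat) : (k < 3)%N -> (inord k + 1 : 'I_3) = inord ((k + 1) %% 3).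
  by move=> k3; apply: val_inj; rewrite /= !inordK ?ltn_mod //.
have i2 (k : nat) : (k < 3)%N -> (inord k + 2 : 'I_3) = inord ((k + 2) %% 3).
  by move=> k3; apply: val_inj; rewrite /= !inordK ?ltn_mod //.
rewrite (vec_co y) (vec_co z) bil_vec crs_vec !vecZ !vecD.
rewrite /oct -/(co _ 0) -/(co _ 1) -/(co _ 2) -/(co _ 3) -/(co _ 4) -/(co _ 5) -/(co _ 6).
rewrite !co_vec7 /zmul /dot /= !sum3 !mxE !inordK //=.
apply: zorn_eq.
- by field.
- apply/colP=> i; rewrite !mxE; case: (inord3 i) => ->; rewrite ?i1 ?i2 // !inordK //=; ring.
- apply/colP=> i; rewrite !mxE; case: (inord3 i) => ->; rewrite ?i1 ?i2 // !inordK //=; ring.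
- by field.
Qed.

Lemma oct_act_oct (A : 'M[C]_7) a y : oct_act A (oct a y) = oct a (A *m y).
Proof. by rewrite /oct_act oct_re_oct oct_im_oct. Qed.

(** An element of G2 fixes the scalars, so it is multiplicative as soon as it
    preserves the scalar and the imaginary parts of the products of imaginary
    octonions. *)
Lemma G2P (A : 'M[C]_7) : G2 A <-> g2 A.
Proof.
split=> [[uA mA]|[uA bA cA]].
  have act y z : oct (bil y z) (A *m crs y z) =
      oct (bil (A *m y) (A *m z)) (crs (A *m y) (A *m z)).
    have := mA (oct 0 y) (oct 0 z).
    by rewrite !oct_act_oct !zmul_oct oct_act_oct !scale0r !mul0r !add0r.
  split=> // y z; first by have := congr1 (@oct_re _) (act y z); rewrite !oct_re_oct.
  by have := congr1 (@oct_im _) (act y z); rewrite !oct_im_oct.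
split=> // z w; rewrite -(octK z) -(octK w) zmul_oct !oct_act_oct zmul_oct bA.
by rewrite !mulmxDr -!scalemxAr cA.
Qed.

End Bridge.

(** * The torus and its normalizer *)

HB.lock Definition chi (R : realType) (r : 'rV[int]_2) (k : 'cV[complex R]_2) :
  complex R := e2pi ((map_mx intr r *m k) 0 0).

Section Torus.
Variable R : realType.
Local Notation C := (complex R).
Implicit Types (k : 'cV[C]_2) (r : 'rV[int]_2).

Lemma chiD r r' k : chi (r + r') k = chi r k * chi r' k.
Proof. by rewrite chi.unlock map_mxD mulmxDl mxE e2piD. Qed.

Lemma chiN r k : chi (- r) k = (chi r k)^-1.
Proof. by rewrite chi.unlock map_mxN mulNmx mxE e2piN. Qed.

Lemma chiZ (n : int) r k : chi (n *: r) k = chi r k ^ n.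
Proof. by rewrite chi.unlock map_mxZ -scalemxAl mxE e2piMz. Qed.

Lemma chi0 k : chi 0 k = 1.
Proof. by rewrite chi.unlock map_mx0 mul0mx mxE e2pi0. Qed.

Lemma chi_neq0 r k : chi r k != 0. Proof. by rewrite chi.unlock e2pi_neq0. Qed.

Lemma e2pi_wt i k : e2pi (wt i k) = chi (v i) k. Proof. by rewrite chi.unlock. Qed.

Lemma wtE k :
  (wt (inord 0) k = k 0 0) * (wt (inord 1) k = k 1 0 - k 0 0) *
  (wt (inord 2) k = 2 * k 0 0 - k 1 0).
Proof.
have s2 (f : 'I_2 -> C) : \sum_i f i = f 0 + f 1.
  by rewrite !big_ord_recl big_ord0 addr0; congr (_ + f _); apply: val_inj.
by do 2?split; rewrite /wt mxE s2 !mxE !inordK //=; ring.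
Qed.

Lemma torus_eltE k : torus_elt k =
  toral (e2pi (k 0 0)) (e2pi (k 0 0 - k 1 0)) (e2pi (k 1 0 - 2 * k 0 0)).
Proof.
rewrite /torus_elt /toral !wtE -!e2piN.
by congr diag_mx; apply/rowP=> j; rewrite !mxE !opprB.
Qed.

(** * Conjugation *)

Lemma conjmxM (g h x : 'M[C]_7) : g \in unitmx -> h \in unitmx ->
  g *m h *m x *m invmx (g *m h) = g *m (h *m x *m invmx h) *m invmx g.
Proof.
by move=> ug uh; have -> : invmx (g *m h) = invmx h *m invmx g;
  [exact: invrM | rewrite !mulmxA].
Qed.

Lemma conjmxVK (g x : 'M[C]_7) : g \in unitmx ->
  invmx g *m (g *m x *m invmx g) *m g = x.
Proof. by move=> ug; rewrite !mulmxA mulVmx // mul1mx mulmxKV. Qed.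

Lemma conjmx_inj (g x y : 'M[C]_7) : g \in unitmx ->
  g *m x *m invmx g = g *m y *m invmx g -> x = y.
Proof.
by move=> ug e; rewrite -(conjmxVK x ug) e; exact: conjmxVK.
Qed.

Lemma conjmx_eq (g x y : 'M[C]_7) : g \in unitmx ->
  g *m x = y *m g <-> g *m x *m invmx g = y.
Proof.
by move=> ug; split=> [->|<-]; rewrite ?mulmxK ?mulmxKV.
Qed.

Lemma char_poly_conjugate (g x : 'M[C]_7) : g \in unitmx ->
  char_poly (g *m x *m invmx g) = char_poly x.
Proof.
move=> ug; pose G : 'M[{poly C}]_7 := map_mx (@polyC C) g.
have GV : G *m map_mx (@polyC C) (invmx g) = 1%:M.
  by rewrite /G -map_mxM mulmxV // map_mx1.
rewrite /char_poly.
have -> : char_poly_mx (g *m x *m invmx g) =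
    G *m char_poly_mx x *m map_mx (@polyC C) (invmx g).
  rewrite /char_poly_mx mulmxBr mulmxBl scalar_mxC -(mulmxA _ G) GV mulmx1.
  by rewrite !map_mxM.
rewrite !det_mulmx mulrAC -det_mulmx GV det1 mul1r //.
Qed.

Lemma torus_normalizer_unit n : torus_normalizer n -> (n : 'M[C]_7) \in unitmx.
Proof. by case=> -[]. Qed.

Lemma torus_normalizerP (n : 'M[C]_7) : torus_normalizer n <->
  [/\ g2 n, forall k, exists k', n *m torus_elt k *m invmx n = torus_elt k' &
    forall k, exists k', n *m torus_elt k' *m invmx n = torus_elt k].
Proof.
split.
  move=> [/G2P gn nT]; split=> // k.
    have : torus (n *m torus_elt k *m invmx n).
      by rewrite -nT; exists (torus_elt k) => //; exists k.
    by case=> k' _ <-; exists k'.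
  have : torus (torus_elt k) by exists k.
  by rewrite -{1}nT => -[_ [k' _ <-]] e; exists k'.
case=> gn h1 h2; split; first exact/G2P.
apply/seteqP; split=> [_ [_ [k _ <-] <-]|_ [k _ <-]].
  by have [k' ->] := h1 k; exists k'.
have [k' <-] := h2 k; exists (torus_elt k') => //; by exists k'.
Qed.

Lemma torus_normalizerM n n' : torus_normalizer n -> torus_normalizer n' ->
  torus_normalizer (n *m n' : 'M[C]_7).
Proof.
move=> /torus_normalizerP[gn n1 n2] /torus_normalizerP[gn' n1' n2'].
have [un _ _] := gn; have [un' _ _] := gn'.
apply/torus_normalizerP; split=> [|k|k]; first exact: g2M.
  have [k1 e1] := n1' k; have [k2 e2] := n1 k1; exists k2.
  by rewrite conjmxM // e1.
have [k1 e1] := n2 k; have [k2 e2] := n2' k1; exists k2.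
by rewrite conjmxM // e2.
Qed.

Lemma torus_normalizerV n : torus_normalizer n ->
  torus_normalizer (invmx n : 'M[C]_7).
Proof.
move=> /torus_normalizerP[gn n1 n2]; have [un _ _] := gn.
apply/torus_normalizerP; split=> [|k|k]; rewrite ?invmxK; first exact: g2V.
  by have [k' <-] := n2 k; exists k'; rewrite conjmxVK.
by have [k' e] := n1 k; exists k'; rewrite -e conjmxVK.
Qed.

Lemma torus_normalizer1 : torus_normalizer (1%:M : 'M[C]_7).
Proof.
apply/torus_normalizerP; split=> [|k|k]; first exact: g2_1.
  by exists k; rewrite mul1mx invmx1 mulmx1.
by exists k; rewrite mul1mx invmx1 mulmx1.
Qed.

Lemma weyl_inv_toral x y z : weyl_inv C *m toral x y z = toral x^-1 y^-1 z^-1 *m weyl_inv C.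
Proof.
apply: mulmx_colP => u; rewrite -!mulmxA !toralE !weyl_invE /weyl_inv_fun !co_vec7 !invrK.
by vec_ring ltac:(ring).
Qed.

Lemma weyl_cycle_toral x y z : weyl_cycle C *m toral x y z = toral y z x *m weyl_cycle C.
Proof.
by apply: mulmx_colP => u; rewrite -!mulmxA !toralE !weyl_cycleE /weyl_cycle_fun !co_vec7.
Qed.

Lemma weyl_swap_toral x y z : weyl_swap C *m toral x y z = toral y x z *m weyl_swap C.
Proof.
apply: mulmx_colP => u; rewrite -!mulmxA !toralE !weyl_swapE /weyl_swap_fun !co_vec7.
by rewrite !mulrN.
Qed.

Definition kvec (a b : C) : 'cV[C]_2 := \col_j nth 0 [:: a; b] j.

Lemma torus_elt_kvec a b : torus_elt (kvec a b) =
  toral (e2pi a) (e2pi (a - b)) (e2pi (b - 2 * a)).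
Proof. by rewrite torus_eltE !mxE. Qed.

Lemma torus_elt_kvecE k : torus_elt k = torus_elt (kvec (k 0 0) (k 1 0)).
Proof. by rewrite torus_elt_kvec torus_eltE. Qed.

Lemma torus_normalizer_weyl_inv : torus_normalizer (weyl_inv C).
Proof.
have [ut _ _] := g2_weyl_inv C.
have e k : weyl_inv C *m torus_elt k *m invmx (weyl_inv C) = torus_elt (- k).
  apply/conjmx_eq; rewrite // !torus_eltE weyl_inv_toral -!e2piN !mxE.
  by congr (toral (e2pi _) (e2pi _) (e2pi _) *m _); ring.
apply/torus_normalizerP; split=> [|k|k]; first exact: g2_weyl_inv.
  by exists (- k); rewrite e.
by exists (- k); rewrite e opprK.
Qed.

Lemma torus_normalizer_weyl_cycle : torus_normalizer (weyl_cycle C).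
Proof.
have [ut _ _] := g2_weyl_cycle C.
have e a b : weyl_cycle C *m torus_elt (kvec a b) *m invmx (weyl_cycle C) =
    torus_elt (kvec (a - b) (3 * a - 2 * b)).
  apply/conjmx_eq; rewrite // !torus_elt_kvec weyl_cycle_toral.
  by congr (toral (e2pi _) (e2pi _) (e2pi _) *m _); ring.
apply/torus_normalizerP; split=> [|k|k]; first exact: g2_weyl_cycle.
  by rewrite torus_elt_kvecE e; eexists.
rewrite torus_elt_kvecE; move: (k 0 0) (k 1 0) => a b.
exists (kvec (b - 2 * a) (b - 3 * a)); rewrite e.
have -> : b - 2 * a - (b - 3 * a) = a by ring.
by have -> : 3 * (b - 2 * a) - 2 * (b - 3 * a) = b by ring.
Qed.

Lemma torus_normalizer_weyl_swap : torus_normalizer (weyl_swap C).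
Proof.
have [ut _ _] := g2_weyl_swap C.
have e a b : weyl_swap C *m torus_elt (kvec a b) *m invmx (weyl_swap C) =
    torus_elt (kvec (a - b) (- b)).
  apply/conjmx_eq; rewrite // !torus_elt_kvec weyl_swap_toral.
  by congr (toral (e2pi _) (e2pi _) (e2pi _) *m _); ring.
apply/torus_normalizerP; split=> [|k|k]; first exact: g2_weyl_swap.
  by rewrite torus_elt_kvecE e; eexists.
rewrite torus_elt_kvecE; move: (k 0 0) (k 1 0) => a b.
exists (kvec (a - b) (- b)); rewrite e opprK.
by have -> : a - b + b = a by ring.
Qed.

End Torus.

(** * Fusion in the torus *)

Section Fusion.
Variable R : realType.
Local Notation C := (complex R).
Implicit Types (x y z : C).

Definition fused (s t : 'M[C]_7) : Prop :=
  exists2 n, torus_normalizer n & n *m s *m invmx n = t.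

Lemma fused_refl s : fused s s.
Proof.
by exists 1%:M; [exact: torus_normalizer1 | rewrite mul1mx invmx1 mulmx1].
Qed.

Lemma fused_trans s t u : fused s t -> fused t u -> fused s u.
Proof.
case=> n nN <- [n' nN' <-]; exists (n' *m n); first exact: torus_normalizerM.
by rewrite conjmxM // torus_normalizer_unit.
Qed.

Definition spectrum6 x y z := [:: x; y; z; x^-1; y^-1; z^-1].

Lemma perm_drop14 (a b b' c c' d e e' f f' : C) :
  perm_eq [:: a; b; c; d; e; f] [:: a; b'; c'; d; e'; f'] =
  perm_eq [:: b; c; e; f] [:: b'; c'; e'; f'].
Proof.
rewrite perm_cons (perm_catCA [:: b; c] [:: d] [:: e; f]).
by rewrite (permPr (permEl (perm_catCA [:: b'; c'] [:: d] [:: e'; f']))) perm_cons.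
Qed.

Lemma char_poly_toral x y z : char_poly (toral x y z) =
  \prod_(a <- 1 :: spectrum6 x y z) ('X - a%:P).
Proof.
rewrite char_poly_trig ?diag_mx_is_trig //.
have -> : \prod_(i < 7) ('X - (toral x y z i i)%:P) =
    \prod_(a <- [:: x; y^-1; z^-1; 1; z; y; x^-1]) ('X - a%:P).
  by rewrite [RHS](big_nth 0) big_mkord; apply: eq_bigr => i _; rewrite !mxE eqxx mulr1n.
by apply: perm_big; apply/seq.permP=> a /=; lia.
Qed.

Lemma toral_cycle_fused x y z : fused (toral x y z) (toral y z x).
Proof.
exists (weyl_cycle C); first exact: torus_normalizer_weyl_cycle.
by apply/conjmx_eq; [have [] := g2_weyl_cycle C | exact: weyl_cycle_toral].
Qed.

Lemma toral_swap_fused x y z : fused (toral x y z) (toral y x z).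
Proof.
exists (weyl_swap C); first exact: torus_normalizer_weyl_swap.
by apply/conjmx_eq; [have [] := g2_weyl_swap C | exact: weyl_swap_toral].
Qed.

Lemma toral_inv_fused x y z : fused (toral x y z) (toral x^-1 y^-1 z^-1).
Proof.
exists (weyl_inv C); first exact: torus_normalizer_weyl_inv.
by apply/conjmx_eq; [have [] := g2_weyl_inv C | exact: weyl_inv_toral].
Qed.

Lemma toral_swap23_fused x y z : fused (toral x y z) (toral x z y).
Proof.
apply: fused_trans (toral_cycle_fused x y z) _; apply: fused_trans (toral_swap_fused y z x) _.
by do 2!(apply: fused_trans (toral_cycle_fused _ _ _) _); exact: fused_refl.
Qed.

Lemma unit_triple x y z : x * y * z = 1 -> [/\ x != 0, y != 0 & z != 0].
Proof.
move=> p; have := oner_neq0 C; rewrite -p !mulf_eq0 !negb_or => /andP[/andP[]].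
by split.
Qed.

Lemma triple_eq x y z z' : x * y * z = 1 -> x * y * z' = 1 -> z' = z.
Proof.
move=> p p'; have [x0 y0 _] := unit_triple p.
by apply: (mulfI (mulf_neq0 x0 y0)); rewrite p p'.
Qed.

(** If only y is inverted, the products being 1 forces y to be its own inverse;
    if y and z both are, they force x to be, so that inverting all three
    does. *)
Lemma spectrum_fused_inv2 x y z z' : x * y * z = 1 -> x * y^-1 * z' = 1 ->
  perm_eq (spectrum6 x y z) (spectrum6 x y^-1 z') ->
  fused (toral x y z) (toral x y^-1 z').
Proof.
move=> p p' e; have [x0 y0 z0] := unit_triple p.
have {e} : perm_eq [:: z; z^-1] [:: z'; z'^-1].
  move: e; rewrite perm_drop14 invrK.
  rewrite (permPr (permEl (perm_catCA [:: y^-1; z'] [:: y] [:: z'^-1]))) perm_cons.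
  by rewrite (perm_catCA [:: z] [:: y^-1] [:: z^-1]) perm_cons.
move/perm_mem/(_ z'); rewrite !inE eqxx /= => /orP[] /eqP z'E.
  have yV : y^-1 = y.
    apply: (mulfI x0); apply: (mulIf z0); rewrite p -z'E p'. by [].
  by rewrite yV z'E; apply: fused_refl.
have xV : x = x^-1.
  have e1 : x * (y * z)^-1 = 1 by rewrite -p' z'E invfM mulrA.
  have e2 : x^-1 = y * z by apply: (mulfI x0); rewrite mulfV // mulrA p.
  by rewrite -e2 invrK in e1; apply: (mulIf x0); rewrite e1 mulVf.
by rewrite z'E {2}xV; exact: toral_inv_fused.
Qed.

Lemma spectrum_fused_aux x y z y' z' :
  x * y * z = 1 -> x * y' * z' = 1 ->
  perm_eq (spectrum6 x y z) (spectrum6 x y' z') ->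
  fused (toral x y z) (toral x y' z').
Proof.
move=> p p' e; have pxzy : x * z * y = 1 by rewrite -p; ring.
have eS : perm_eq (spectrum6 x z y) (spectrum6 x y' z').
  by apply/seq.permP=> a; rewrite -(seq.permP e a) /=; lia.
have : perm_eq [:: y; z; y^-1; z^-1] [:: y'; z'; y'^-1; z'^-1].
  by rewrite -(perm_drop14 x _ _ _ _ x^-1).
move/perm_mem/(_ y'); rewrite !inE eqxx /=.
case/or4P=> /eqP y'E; rewrite y'E in p' e eS *.
- by rewrite (triple_eq p p'); apply: fused_refl.
- by apply: fused_trans (toral_swap23_fused _ _ _) _; rewrite (triple_eq pxzy p'); apply: fused_refl.
- exact: spectrum_fused_inv2.
- by apply: fused_trans (toral_swap23_fused _ _ _) _; exact: spectrum_fused_inv2.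
Qed.

(** The multiset of the eigenvalues determines the triple up to permutations
    and global inversion, that is up to the Weyl group. *)
Lemma spectrum_fused x y z x' y' z' :
  x * y * z = 1 -> x' * y' * z' = 1 ->
  perm_eq (spectrum6 x y z) (spectrum6 x' y' z') ->
  fused (toral x y z) (toral x' y' z').
Proof.
have pos a b c : a * b * c = 1 -> x' * y' * z' = 1 ->
    perm_eq (spectrum6 a b c) (spectrum6 x' y' z') -> x' \in [:: a; b; c] ->
    fused (toral a b c) (toral x' y' z').
  move=> p p' e; rewrite !inE => /or3P[] /eqP xE; rewrite xE in p' e *.
  - exact: spectrum_fused_aux.
  - apply: fused_trans (toral_cycle_fused _ _ _) _; apply: spectrum_fused_aux => //.
      by rewrite -p; ring.
    by apply/seq.permP=> q; rewrite -(seq.permP e q) /=; lia.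
  - do 2!(apply: fused_trans (toral_cycle_fused _ _ _) _); apply: spectrum_fused_aux => //.
      by rewrite -p; ring.
    by apply/seq.permP=> q; rewrite -(seq.permP e q) /=; lia.
move=> p p' e; have [x0 y0 z0] := unit_triple p.
have : x' \in spectrum6 x y z by rewrite (perm_mem e) inE eqxx.
rewrite -[spectrum6 x y z]/([:: x; y; z] ++ [:: x^-1; y^-1; z^-1]) mem_cat.
case/orP=> x'E; first exact: pos.
apply: fused_trans (toral_inv_fused _ _ _) _; apply: pos => //.
  by rewrite -!invfM p invr1.
rewrite /spectrum6 !invrK -(perm_catC [:: x; y; z] [:: x^-1; y^-1; z^-1]).
exact: e.
Qed.

(** Conjugate matrices have the same eigenvalues. *)
Lemma conjugate_fused g x y z x' y' z' :
  x * y * z = 1 -> x' * y' * z' = 1 -> g \in unitmx ->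
  g *m toral x y z *m invmx g = toral x' y' z' -> fused (toral x y z) (toral x' y' z').
Proof.
move=> p p' ug e; apply: spectrum_fused => //.
have := char_poly_conjugate (toral x y z) ug.
by rewrite e !char_poly_toral => /prod_XsubC_eq; rewrite perm_cons perm_sym.
Qed.

End Fusion.

(** * Torsion points of the torus *)

Section Torsion.
Variable R : realType.
Local Notation C := (complex R).
Variable m : nat.
Hypothesis m0 : (0 < m)%N.
Implicit Types (a b : {ffun 'I_2 -> 'I_m}) (r : 'rV[int]_2).

Definition pt a : 'cV[C]_2 := \col_j ((a j)%:R / m%:R).

Definition dot_pt r a : int := \sum_j r 0 j * (a j)%:Z.

Lemma chi_pt r a : chi r (pt a) = zeta R m ^ dot_pt r a.
Proof.
have mC : (m%:R : C) != 0 by rewrite pnatr_eq0 -lt0n.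
rewrite /zeta -e2piMz chi.unlock; congr e2pi.
rewrite mxE /dot_pt rmorph_sum /= mulr_suml; apply: eq_bigr => j _.
by rewrite !mxE rmorphM /= mulrA.
Qed.

Lemma zeta_eq1 (n : int) : (zeta R m ^ n == 1) = (m %| n)%Z.
Proof.
have z := zeta_prim R m0.
case: n => n; first by rewrite dvdzE -exprnP -(prim_order_dvd z).
by rewrite dvdzE NegzE -exprnN invr_eq1 -(prim_order_dvd z).
Qed.

Lemma chi_pt_eq1 r a : (chi r (pt a) == 1) = (m %| dot_pt r a)%Z.
Proof. by rewrite chi_pt zeta_eq1. Qed.

Lemma row_killsE i a : row_kills i a = (chi (row i P) (pt a) == 1).
Proof.
rewrite chi_pt_eq1 /row_kills /dot_pt; congr (_ %| _)%Z.
by apply: eq_bigr => j _; rewrite [row i P _ _]mxE.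
Qed.

Lemma toral_torsion (x y z : C) : x * y * z = 1 -> toral x y z ^+ m = 1 ->
  exists a, torus_elt (pt a) = toral x y z.
Proof.
move=> p; rewrite toralX => e; have z1 := zeta_prim R m0.
have [x0 y0 _] := unit_triple p.
have [xm ym _] : [/\ x ^+ m = 1, y ^+ m = 1 & z ^+ m = 1].
  by apply: toral_inj; rewrite e toral1.
have [i xE] := prim_rootP z1 xm.
have [j yE] : {j : 'I_m | x / y = zeta R m ^+ j}.
  by apply: prim_rootP => //; rewrite expr_div_n xm ym divr1.
exists [ffun k : 'I_2 => if k == 0 then i else j].
rewrite torus_eltE !mxE !ffunE /= !e2piD !e2piN -!zetaX -xE -yE.
have -> : e2pi (2 * (i%:R / m%:R)) = x ^+ 2 :> C.
  by rewrite mulr_natl mulr2n e2piD -zetaX -xE.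
have -> : x / (x / y) = y by rewrite invf_div mulrC divfK.
have -> : x / y / x ^+ 2 = (x * y)^-1.
  by field; rewrite x0 y0.
by congr toral; apply: (mulfI (mulf_neq0 x0 y0)); rewrite p mulfV // mulf_neq0.
Qed.

Lemma triple_torus_elt (k : 'cV[C]_2) :
  e2pi (k 0 0) * e2pi (k 0 0 - k 1 0) * e2pi (k 1 0 - 2 * k 0 0) = 1.
Proof. by rewrite -!e2piD -[RHS](e2pi0 R); congr e2pi; ring. Qed.

Lemma torus_elt_torsion (k : 'cV[C]_2) : torus_elt k ^+ m = 1 ->
  exists a, torus_elt k = torus_elt (pt a).
Proof.
rewrite torus_eltE => /toral_torsion; case; first exact: triple_torus_elt.
by move=> a <-; exists a.
Qed.

Lemma torus_elt_eq (k k' : 'cV[C]_2) :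
  chi (v (inord 0)) k = chi (v (inord 0)) k' ->
  chi (v (inord 1)) k = chi (v (inord 1)) k' -> torus_elt k = torus_elt k'.
Proof.
rewrite -!e2pi_wt !wtE => e0 e1; rewrite !torus_eltE.
have e (h : 'cV[C]_2) : (e2pi (h 0 0 - h 1 0) = (e2pi (h 1 0 - h 0 0))^-1) *
    (e2pi (h 1 0 - 2 * h 0 0) = e2pi (h 1 0 - h 0 0) / e2pi (h 0 0)).
  by rewrite -!e2piN -e2piD; split; congr e2pi; ring.
by rewrite !e e0 e1.
Qed.

Lemma torus_elt_chi (k k' : 'cV[C]_2) : torus_elt k = torus_elt k' ->
  forall i, chi (v i) k = chi (v i) k'.
Proof.
rewrite !torus_eltE => /toral_inj[e0 e1 e2] i; rewrite -!e2pi_wt.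
have flip (c d : C) : e2pi c = e2pi d -> e2pi (- c) = e2pi (- d).
  by rewrite !e2piN => ->.
case: (inord3 i) => ->; rewrite !wtE //.
  by have := flip _ _ e1; rewrite !opprB.
by have := flip _ _ e2; rewrite !opprB.
Qed.

Lemma torus_elt_pt_inj a b :
  torus_elt (pt a) = torus_elt (pt b) -> a = b.
Proof.
move=> e; have z1 := zeta_prim R m0.
have := torus_elt_chi e (inord 0); have := torus_elt_chi e (inord 1).
rewrite -!e2pi_wt !wtE !e2piD !e2piN !mxE -!zetaX => e1 e0.
have inj (i j : 'I_m) : zeta R m ^+ i = zeta R m ^+ j -> i = j.
  move=> ij; have := eq_prim_root_expr z1 i j; rewrite ij eqxx.
  rewrite (modn_small (ltn_ord i)) (modn_small (ltn_ord j)).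
  move/esym/eqP.
  exact: ord_inj.
rewrite e0 in e1.
have u0 : (zeta R m ^+ b 0)^-1 != 0 by rewrite invr_eq0 zetaX e2pi_neq0.
apply/ffunP=> j; case: j => -[|[|//]] j2.
  by rewrite (_ : Ordinal j2 = 0); [exact: inj | exact: val_inj].
rewrite (_ : Ordinal j2 = 1); last exact: val_inj.
exact: inj (mulIf u0 e1).
Qed.

Lemma torus_elt_pt_torsion a : torus_elt (pt a) ^+ m = 1.
Proof.
have root j : e2pi (pt a j 0) ^+ m = 1.
  rewrite mxE -zetaX exprAC (prim_expr_order (zeta_prim R m0)).
  exact: expr1n.
have dbl (u : C) : e2pi (2 * u) = e2pi u ^+ 2.
  by rewrite mulr_natl mulr2n e2piD.
rewrite torus_eltE toralX e2piD e2piD !e2piN dbl.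
have := root 0; have := root 1; move: (e2pi _) (e2pi _) => y x ym xm.
by rewrite !exprMn !exprVn exprAC xm ym expr1n !invr1 !mulr1 toral1.
Qed.

End Torsion.

(** * Signed permutations *)

Section SignedPermutations.
Variable R : realType.
Local Notation C := (complex R).

Lemma vE : (v (inord 0) = \row_j nth 0 [:: 1; 0] j) *
  (v (inord 1) = \row_j nth 0 [:: -1; 1] j) *
  (v (inord 2) = \row_j nth 0 [:: 2; -1] j).
Proof. by rewrite /v !inordK. Qed.

(** The point of order 7 with exponents P1 = 3, P2 = 1 and P3 = 2: the seven
    weights 0, P1, -P1, P2, -P2, P3, -P3 are distinct modulo 7 on it. *)
Definition generic : {ffun 'I_2 -> 'I_7} :=
  [ffun j : 'I_2 => inord (nth 0 [:: 3; 4] j)]%N.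

Lemma chi_generic i : chi (v i) (pt R generic) =
  zeta R 7 ^+ nth 0%N [:: 3; 1; 2]%N i.
Proof.
rewrite chi_pt // /dot_pt exprnP; congr (_ ^ _).
rewrite !big_ord_recl big_ord0 !ffunE !inordK //=.
by case: (inord3 i) => ->; rewrite vE !mxE !inordK.
Qed.

Definition weight (j : 'I_7) : 'rV[int]_2 :=
  nth 0 [:: v (inord 0); v (inord 1); v (inord 2); 0;
         - v (inord 2); - v (inord 1); - v (inord 0)] j.

Lemma torus_elt_diag (k : 'cV[C]_2) : torus_elt k = diag_mx (\row_j chi (weight j) k).
Proof.
rewrite /torus_elt; congr diag_mx; apply/rowP=> j; rewrite !mxE /weight.
by case: j => -[|[|[|[|[|[|[|]]]]]]] //= _; rewrite ?chiN ?chi0 ?e2piN ?e2pi_wt.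
Qed.

(** A matrix element n_ij that is nonzero links the eigenvalue of a torus
    element at position j to the eigenvalue of its conjugate at position i. *)
Lemma conj_entry (n : 'M[C]_7) (k k' : 'cV[C]_2) i j : n \in unitmx ->
  n *m torus_elt k *m invmx n = torus_elt k' -> n i j != 0 ->
  chi (weight i) k' = chi (weight j) k.
Proof.
move=> un /conjmx_eq -/(_ un) e nij.
have := congr1 (fun M : 'M[C]_7 => M i j) e.
rewrite !torus_elt_diag mul_mx_diag mul_diag_mx !mxE mulrC => /esym.
exact: mulIf.
Qed.

Lemma unit_row_neq0 (n : 'M[C]_7) i : n \in unitmx -> exists j, n i j != 0.
Proof.
move=> un; apply/existsP; apply: contraT; rewrite negb_exists => /forallP n0.
have : delta_mx 0 i *m n *m invmx n = 0 :> 'rV[C]_7.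
  rewrite -rowE (_ : row i n = 0) ?mul0mx //.
  by apply/rowP=> j; rewrite !mxE; apply/eqP; rewrite -[_ == _]negbK n0.
rewrite mulmxK // => /matrixP/(_ 0 i)/eqP.
by rewrite !mxE !eqxx oner_eq0.
Qed.

Definition absw (j : 'I_7) : 'I_3 := inord (if (j < 3)%N then j else 6 - j).
Definition negw (j : 'I_7) : bool := (3 < j)%N.

Definition signed (b : bool) (r : 'rV[int]_2) := if b then - r else r.

Lemma e2pi_signed (b : bool) i (k : 'cV[C]_2) :
  e2pi ((-1) ^+ b * wt i k) = chi (signed b (v i)) k.
Proof.
by case: b; rewrite /= ?mulN1r ?mul1r ?e2piN ?chiN e2pi_wt.
Qed.

Lemma weightE (j : 'I_7) : j != inord 3 :> 'I_7 ->
  weight j = signed (negw j) (v (absw j)).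
Proof.
rewrite -val_eqE /= inordK // /weight /absw /negw.
by case: j => -[|[|[|[|[|[|[|]]]]]]] //=.
Qed.

(** A nonzero entry in the row of weight P_i links P_i to some weight.  That this
    weight is not 0, and that different i lead to weights different up to sign,
    is seen on a conjugate of the generic point. *)
Lemma normalizer_signed_perm (n : 'M[C]_7) : torus_normalizer n ->
  exists sg : signed_perm3, forall (k k' : 'cV[C]_2) (i : 'I_3),
    n *m torus_elt k *m invmx n = torus_elt k' ->
    chi (v i) k' = chi (signed (sg.2 i) (v (sg.1 i))) k.
Proof.
move=> nN; have un := torus_normalizer_unit nN.
have [_ _ surj] := (torus_normalizerP n).1 nN.
pose d (i : 'I_3) : 'I_7 := inord i.
have wd i : weight (d i) = v i.
  by rewrite /weight /d inordK ?(leq_trans (ltn_ord i)) //;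
     case: (inord3 i) => ->; rewrite inordK.
have ex i : exists j, n (d i) j != 0 := unit_row_neq0 (d i) un.
pose pi i := xchoose (ex i).
have piE i k k' : n *m torus_elt k *m invmx n = torus_elt k' ->
    chi (v i) k' = chi (weight (pi i)) k.
  by move=> e; rewrite -wd; apply: (conj_entry un e); exact: (xchooseP (ex i)).
have [k0 e0] := surj (pt R generic).
have gen i := piE i _ _ e0.
have z7 := @zeta_prim R 7 isT.
have pi3 i : pi i != inord 3.
  apply/eqP=> e; have := gen i; rewrite e /weight inordK //= chi0 chi_generic.
  move/eqP; rewrite -(prim_order_dvd z7).
  by case: (inord3 i) => ->; rewrite inordK.
have piv i k k' : n *m torus_elt k *m invmx n = torus_elt k' ->
    chi (v i) k' = chi (signed (negw (pi i)) (v (absw (pi i)))) k.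
  by move/piE->; rewrite weightE.
have inj : injective (absw \o pi).
  move=> i i' /= e; have := piv i _ _ e0; have := piv i' _ _ e0.
  rewrite e !chi_generic; set w := v (absw (pi i')).
  pose c (j : 'I_3) := nth 0%N [:: 3; 1; 2]%N j; rewrite -/(c i) -/(c i').
  have same : zeta R 7 ^+ c i = zeta R 7 ^+ c i' -> i = i'.
    move=> h; have := eq_prim_root_expr z7 (c i) (c i'); rewrite h eqxx /c.
    by case: (inord3 i) => ->; case: (inord3 i') => ->; rewrite ?inordK.
  have opp : zeta R 7 ^+ c i * zeta R 7 ^+ c i' = 1 -> i = i'.
    rewrite -exprD => /eqP; rewrite -(prim_order_dvd z7) /c.
    by case: (inord3 i) => ->; case: (inord3 i') => ->; rewrite ?inordK.
  have z0 := chi_neq0 w k0.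
  case: (negw _) (negw _) => -[]; rewrite /= ?chiN => h' h.
  - by apply: same; rewrite h h'.
  - by apply: opp; rewrite h h' ?mulfV ?mulVf.
  - by apply: opp; rewrite h h' ?mulfV ?mulVf.
  - by apply: same; rewrite h h'.
exists (perm inj, [ffun i => negw (pi i)]) => k k' i e.
by rewrite (piv i _ _ e) permE ffunE.
Qed.

Variables (gT : finGroupType) (W : {group gT}) (q : 'M[C]_7 -> gT).
Hypothesis hW : is_weyl_group W q.

Lemma weyl_lift w : w \in W -> exists2 n, torus_normalizer n & q n = w.
Proof.
case: hW => _ qW _ wW; have : [set u | u \in W]%classic w by [].
by rewrite -qW => -[n nN <-]; exists n.
Qed.

Lemma torus_elt_comm (k k' : 'cV[C]_2) :
  torus_elt k *m torus_elt k' = torus_elt k' *m torus_elt k.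
Proof. by rewrite (torus_eltE k) (torus_eltE k'); exact: toral_comm. Qed.

(** Two lifts differ by an element of the torus, which is commutative. *)
Lemma weyl_lift_unique n n' : torus_normalizer n -> torus_normalizer n' ->
  q n = q n' -> forall k : 'cV[C]_2,
  n *m torus_elt k *m invmx n = n' *m torus_elt k *m invmx n'.
Proof.
move=> nN n'N e k; have [qM _ q1] := hW.
have un := torus_normalizer_unit nN; have un' := torus_normalizer_unit n'N.
have hN := torus_normalizerM (torus_normalizerV nN) n'N.
have [h0 _ hE] : torus (invmx n *m n').
  apply/(q1 _ hN); have := qM _ _ nN hN; rewrite mulKVmx // -e.
  by move/(canLR (mulKg _)) => <-; rewrite mulVg.
have -> : n' = n *m torus_elt h0 by rewrite hE mulKVmx.
have uh : torus_elt h0 \in unitmx.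
  by rewrite hE unitmx_mul unitmx_inv un un'.
by rewrite conjmxM // (torus_elt_comm h0 k) (mulmxK uh).
Qed.

Lemma sigmaP w : w \in W -> is_sigma q w (sigma q w).
Proof.
move=> wW; rewrite /sigma; case: pickP => [sg /asboolP //|none].
have [n nN qn] := weyl_lift wW; have [sg sgP] := normalizer_signed_perm nN.
suff sgs : is_sigma q w sg by have := none sg; rewrite asboolT.
move=> n' k i n'N qn' /=.
have [_ stab _] := (torus_normalizerP n).1 nN; have [k' e] := stab k.
rewrite (weyl_lift_unique n'N nN); last by rewrite qn qn'.
rewrite e torus_elt_diag !mxE eqxx mulr1n.
have -> : weight (widen_ord (isT : (3 <= 7)%N) i) = v i.
  by rewrite /weight; case: (inord3 i) => ->; rewrite /= inordK.
by rewrite (sgP _ _ _ e) e2pi_signed.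
Qed.

Lemma conj_chi w n (k k' : 'cV[C]_2) i : w \in W -> torus_normalizer n ->
  q n = w -> n *m torus_elt k *m invmx n = torus_elt k' ->
  chi (v i) k' = chi (signed ((sigma q w).2 i) (v ((sigma q w).1 i))) k.
Proof.
move=> wW nN qn e; have := sigmaP wW k i nN qn; rewrite /= e.
rewrite torus_elt_diag !mxE eqxx mulr1n.
have -> : weight (widen_ord (isT : (3 <= 7)%N) i) = v i.
  by rewrite /weight; case: (inord3 i) => ->; rewrite /= inordK.
by move->; rewrite e2pi_signed.
Qed.

End SignedPermutations.

(** * Fixed points and strata *)

Definition row2 (a b : int) : 'rV[int]_2 := \row_j nth 0 [:: a; b] j.

Lemma row2D a b c d : row2 a b + row2 c d = row2 (a + c) (b + d).
Proof. by apply/rowP=> -[[|[|//]] j2]; rewrite !mxE. Qed.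

Lemma row2N a b : - row2 a b = row2 (- a) (- b).
Proof. by apply/rowP=> -[[|[|//]] j2]; rewrite !mxE. Qed.

Lemma row2Z a b c : c *: row2 a b = row2 (c * a) (c * b).
Proof. by apply/rowP=> -[[|[|//]] j2]; rewrite !mxE. Qed.

Lemma v_row2 : (v (inord 0) = row2 1 0) * (v (inord 1) = row2 (-1) 1) *
  (v (inord 2) = row2 2 (-1)).
Proof. by rewrite !vE. Qed.

Lemma row_P k : (k < 9)%N ->
  row (inord k : 'I_9) P = row2
    (nth 0 [:: 1; 1; 2; 2; 0; 3; 2; 3; 4] k)
    (nth 0 [:: 0; -1; -1; 0; 1; -1; -2; -2; -2] k).
Proof.
move=> k9; apply/rowP=> -[[|[|//]] j2]; rewrite !mxE inordK //.
  by move: k k9; do 9?case=> //.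
by move: k k9; do 9?case=> //.
Qed.

Lemma is_row_of_index (k : nat) x :
  row (inord k) P = x \/ row (inord k) P = - x -> is_row [set: 'I_9] x.
Proof.
move=> e; apply/existsP; exists (inord k); rewrite finset.in_setT /=.
by case: e => ->; rewrite eqxx ?orbT.
Qed.

(** P was chosen so that its rows exhaust these vectors up to sign. *)
Lemma is_row_v i : is_row [set: 'I_9] (v i).
Proof.
case: (inord3 i) => ->; rewrite v_row2.
- by apply: (@is_row_of_index 0); left; rewrite row_P.
- by apply: (@is_row_of_index 1); right; rewrite row_P // row2N.
- by apply: (@is_row_of_index 2); left; rewrite row_P.
Qed.

Lemma is_row_2v i : is_row [set: 'I_9] (2 *: v i).
Proof.
case: (inord3 i) => ->; rewrite v_row2 row2Z.
- by apply: (@is_row_of_index 3); left; rewrite row_P.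
- by apply: (@is_row_of_index 6); right; rewrite row_P // row2N.
- by apply: (@is_row_of_index 8); left; rewrite row_P.
Qed.

Lemma is_rowN S x : is_row S (- x) = is_row S x.
Proof. by apply: eq_existsb => r; rewrite opprK orbC. Qed.

Lemma is_row_vB i j : i != j -> is_row [set: 'I_9] (v i - v j).
Proof.
wlog: i j / (i < j)%N => [hw ij|].
  case: (ltngtP i j) => [ltij|ltij|/val_inj e]; first exact: hw.
    by rewrite -is_rowN opprB hw // eq_sym.
  by rewrite e eqxx in ij.
case: (inord3 i) => ->; case: (inord3 j) => ->; rewrite !inordK // => _ _.
- rewrite !v_row2 row2N row2D.
  by apply: (@is_row_of_index 2); left; rewrite row_P.
- rewrite !v_row2 row2N row2D.
  by apply: (@is_row_of_index 1); right; rewrite row_P // row2N.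
- rewrite !v_row2 row2N row2D.
  by apply: (@is_row_of_index 7); right; rewrite row_P // row2N.
Qed.

Lemma is_row_vD i j : i != j -> is_row [set: 'I_9] (v i + v j).
Proof.
wlog: i j / (i < j)%N => [hw ij|].
  case: (ltngtP i j) => [ltij|ltij|/val_inj e]; first exact: hw.
    by rewrite addrC hw // eq_sym.
  by rewrite e eqxx in ij.
case: (inord3 i) => ->; case: (inord3 j) => ->; rewrite !inordK // => _ _.
- rewrite !v_row2 row2D.
  by apply: (@is_row_of_index 4); left; rewrite row_P.
- rewrite !v_row2 row2D.
  by apply: (@is_row_of_index 5); left; rewrite row_P.
- rewrite !v_row2 row2D.
  by apply: (@is_row_of_index 0); left; rewrite row_P.
Qed.

Section FixedPoints.
Variable R : realType.
Local Notation C := (complex R).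
Variable m : nat.
Hypothesis m0 : (0 < m)%N.
Implicit Types (a : {ffun 'I_2 -> 'I_m}).

Definition stratum a : submat := [set r | row_kills r a].

Lemma killsE (S : submat) a : kills S a = (S \subset stratum a).
Proof.
apply/forall_inP/fintype.subsetP => h r rS; first by rewrite inE h.
by have := h r rS; rewrite inE.
Qed.

Lemma in_stratum r a : (r \in stratum a) = (chi (row r P) (pt R a) == 1).
Proof. by rewrite inE (row_killsE R m0). Qed.

Lemma is_row_chi (S : submat) x a : S \subset stratum a -> is_row S x ->
  chi x (pt R a) = 1.
Proof.
move=> /fintype.subsetP sS /existsP[r /andP[/sS rS e]].
move: rS; rewrite in_stratum => /eqP c1; case/orP: e => /eqP e.
  by rewrite -e c1.
by rewrite -[x]opprK -e chiN c1 invr1.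
Qed.

Lemma chi_is_row x a : is_row [set: 'I_9] x -> chi x (pt R a) = 1 ->
  is_row (stratum a) x.
Proof.
case/existsP=> r /andP[_ e] c1; apply/existsP; exists r; rewrite e andbT.
by rewrite in_stratum; case/orP: e => /eqP ->; rewrite ?chiN c1 ?invr1.
Qed.

(** Triviality at a point is inherited by integer combinations of characters. *)
Lemma stratum_in_Mposet a : stratum a \in Mposet.
Proof.
rewrite inE; apply/forallP=> r; apply/implyP => /asboolP[c e].
rewrite in_stratum e; apply/eqP.
rewrite (big_morph (fun y => chi y (pt R a)) (fun x y => chiD x y _) (chi0 _)).
apply: big1 => i; rewrite in_stratum => /eqP ci.
by rewrite chiZ ci exp1rz.
Qed.

Lemma f_E S : S \in Mposet ->
  f_ m S = #|[set a : {ffun 'I_2 -> 'I_m} | stratum a == S]|.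
Proof.
move=> SM; rewrite /f_; apply: eq_card => a; rewrite !inE killsE.
apply/andP/eqP => [[sS /forallP no]|<-].
  apply/eqP; rewrite finset.eqEsubset sS andbT; apply: contraT => nS.
  have := no (stratum a); rewrite /prec properE sS nS /= killsE subxx.
  by [].
split; first exact: subxx.
by apply/forallP=> T; apply/implyP; rewrite /prec killsE properE => /andP[].
Qed.

Lemma g_E S : g_ m S = #|[set a : {ffun 'I_2 -> 'I_m} | S \subset stratum a]|.
Proof. by rewrite /g_; apply: eq_card => a; rewrite !inE killsE. Qed.

Variables (gT : finGroupType) (W : {group gT}) (q : 'M[C]_7 -> gT).
Hypothesis hW : is_weyl_group W q.

Lemma sigma_vec_chi (sg : signed_perm3) i (k : 'cV[C]_2) :
  chi (signed (sg.2 i) (v (sg.1 i))) k = chi (v i) k <->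
  (if sigma_vec sg i is Some x then chi x k = 1 else True).
Proof.
have nz r := chi_neq0 r k.
have div1 (x y : C) : x != 0 -> y = x <-> x / y = 1.
  move=> x0; split=> [->|e]; first exact: mulfV.
  have [y0|y0] := eqVneq y 0.
    by move/eqP: e; rewrite y0 invr0 mulr0 eq_sym oner_eq0.
  by rewrite -[LHS]mul1r -e divfK.
rewrite /sigma_vec; case: eqP => [->|_]; case: (sg.2 i) => /=.
- rewrite scaler_nat mulr2n chiD chiN.
  by rewrite (div1 _ _ (nz (v i))) invrK.
- by [].
- by rewrite chiD chiN (div1 _ _ (nz (v i))) invrK.
- by rewrite chiD chiN (div1 _ _ (nz (v i))).
Qed.

Lemma sigma_vec_row (sg : signed_perm3) i x : sigma_vec sg i = Some x ->
  is_row [set: 'I_9] x.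
Proof.
rewrite /sigma_vec; case: eqP => [_|/eqP ne].
  by case: ifP => // _ [<-]; exact: is_row_2v.
rewrite eq_sym in ne.
by case: ifP => _ [<-]; [exact: is_row_vD | exact: is_row_vB].
Qed.

Lemma kills_S_of (sg : signed_perm3) a : kills (S_of sg) a <->
  forall i : 'I_3, (i < 2)%N ->
    if sigma_vec sg i is Some x then chi x (pt R a) = 1 else True.
Proof.
rewrite killsE; split=> [sS i i2|h].
  case E: (sigma_vec sg i) => [x|] //; apply: (is_row_chi sS).
  have /existsP[r /andP[_ e]] := sigma_vec_row E.
  apply/existsP; exists r; rewrite e andbT inE.
  by apply/existsP; exists i; rewrite i2 E.
apply/fintype.subsetP=> r; rewrite inE => /existsP[i /andP[i2]].
have := h i i2; case: (sigma_vec sg i) => // x cx e.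
by rewrite in_stratum; case/orP: e => /eqP ->; rewrite ?chiN cx ?invr1.
Qed.

(** An element of the torus is determined by its eigenvalues of weights P1 and
    P2: this is why S_of may restrict to i < 2. *)
Lemma fixed_iff_kills w n a : w \in W -> torus_normalizer n -> q n = w ->
  n *m torus_elt (pt R a) *m invmx n = torus_elt (pt R a) <->
  kills (S_of (sigma q w)) a.
Proof.
move=> wW nN qn; rewrite kills_S_of; split=> [e i i2|h].
  by apply/sigma_vec_chi; rewrite -(conj_chi hW _ wW nN qn e).
have [_ stab _] := (torus_normalizerP n).1 nN; have [k' e] := stab (pt R a).
rewrite e; apply: torus_elt_eq.
  rewrite (conj_chi hW _ wW nN qn e); apply/sigma_vec_chi/h.
  by rewrite inordK.
rewrite (conj_chi hW _ wW nN qn e); apply/sigma_vec_chi/h.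
by rewrite inordK.
Qed.

End FixedPoints.

(** * Counting up to inversion *)

Lemma card_image_uniq (T : eqType) (U : Type) (l : seq T) (g : T -> U) :
  uniq l -> {in l &, injective g} ->
  ([set y | exists2 x, x \in l & g x = y]%classic #= `I_(size l))%card.
Proof.
case: l => [|x0 l0] ul ig.
  by rewrite [size _]/= II0 card_eq0; apply/eqP/seteqP; split=> // y [].
set l := x0 :: l0 in ul ig *.
have -> : [set y | exists2 x, x \in l & g x = y]%classic =
    ((fun i => g (nth x0 l i)) @` `I_(size l))%classic.
  apply/seteqP; split=> [y [x xl <-]|y [i il <-]] /=.
    by exists (index x l); [rewrite /mkset index_mem | rewrite nth_index].
  by exists (nth x0 l i); first exact: mem_nth.
apply: inj_card_eq => i j /set_mem il /set_mem jl /ig.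
by rewrite !mem_nth // => /(_ isT isT)/eqP; rewrite nth_uniq // => /eqP.
Qed.

Lemma card_mem_seq (T : eqType) (l : seq T) :
  ([set x | x \in l]%classic #= `I_(size (undup l)))%card.
Proof.
rewrite (_ : [set x | _]%classic = [set y | exists2 x, x \in undup l & id x = y]%classic).
  by apply: card_image_uniq; rewrite ?undup_uniq.
by apply/seteqP; split=> x /=; [exists x; rewrite ?mem_undup | case=> y; rewrite mem_undup => ? <-].
Qed.

Lemma size_undup_map (T : eqType) (U V : eqType) (f : T -> U) (g : T -> V) s :
  (forall x y, f x = f y <-> g x = g y) ->
  size (undup (map f s)) = size (undup (map g s)).
Proof.
move=> fg; elim: s => //= x s IHs.
have -> : (f x \in map f s) = (g x \in map g s).
  by apply/mapP/mapP => -[y ys e]; exists y => //; apply/fg.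
by case: ifP => _; rewrite /= IHs.
Qed.

Lemma eq_size_undup (T : eqType) (s t : seq T) : s =i t ->
  size (undup s) = size (undup t).
Proof.
move=> st; apply/perm_size/uniq_perm; rewrite ?undup_uniq // => x.
by rewrite !mem_undup.
Qed.

Lemma card_equivalence_partition (T : finType) (V : eqType) (e : rel T)
    (g : T -> V) : (forall x y, e x y = (g x == g y)) ->
  #|equivalence_partition e [set: T]| = size (undup (map g (enum T))).
Proof.
move=> eg; pose f x := [set y in [set: T] | e x y].
rewrite (_ : size _ = size (undup (map f (enum T)))).
  rewrite -(card_uniqP (undup_uniq _)); apply: eq_card => B.
  rewrite mem_undup; apply/imsetP/mapP => -[x _ ->]; exists x => //.
  by rewrite mem_enum.
apply: size_undup_map => x y; rewrite /f; split=> [e1|/setP/(_ y)].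
  by apply/setP=> z; rewrite !inE !eg e1.
by rewrite !inE !eg eqxx => /eqP.
Qed.

Section CountingInverses.
Variable F : numClosedFieldType.
Implicit Types (u w : F) (s : seq F).

(** This separates the classes of the relation identifying u with 1 / u. *)
Definition inv_key u : F := u + u^-1.

Lemma inv_keyP u w : u != 0 -> w != 0 ->
  inv_key u = inv_key w <-> w = u \/ w = u^-1.
Proof.
move=> u0 w0; rewrite /inv_key; split=> [e|[]->]; rewrite ?invrK //; last exact: addrC.
have : (w - u) * (w - u^-1) = 0.
  have -> : (w - u) * (w - u^-1) = w * (w + w^-1) - w * (u + u^-1) + (u * u^-1 - w * w^-1) by ring.
  by rewrite e !mulfV // !subrr addr0.
by move/eqP; rewrite mulf_eq0 !subr_eq0 => /orP[]/eqP; [left|right].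
Qed.

Lemma opp1_neq1 : -1 != 1 :> F.
Proof. by rewrite -subr_eq0 -opprD oppr_eq0 -mulr2n pnatr_eq0. Qed.

Lemma inv_key1 u : u != 0 -> inv_key u = inv_key 1 -> u = 1.
Proof.
by move=> u0 /esym/inv_keyP; rewrite oner_neq0 u0 => /(_ isT isT); rewrite invr1; case.
Qed.

Lemma inv_keyN1 u : u != 0 -> inv_key u = inv_key (-1) -> u = -1.
Proof.
move=> u0 /esym/inv_keyP; rewrite oppr_eq0 oner_neq0 u0 => /(_ isT isT).
by rewrite invrN invr1; case.
Qed.

Lemma div_eq1 u w : w != 0 -> u / w = 1 <-> w = u.
Proof.
move=> w0; split=> [e|<-]; last exact: mulfV.
by rewrite -[u](divfK w0) e mul1r.
Qed.

Lemma mul_eq1 u w : u != 0 -> u * w = 1 <-> w = u^-1.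
Proof.
by move=> u0; split=> [e|->]; [apply: (mulfI u0); rewrite e mulfV | exact: mulfV].
Qed.

Lemma sqr_eq1 u : u != 0 -> (u == u^-1) = (u == 1) || (u == -1).
Proof.
move=> u0; rewrite -(inj_eq (mulfI u0)) mulfV //.
by rewrite -expr2 sqrf_eq1.
Qed.

Definition inv_closure s := 1 :: -1 :: s ++ map GRing.inv s.

Lemma mem_inv_closure u s : u != 0 -> all (fun w => w != 0) s ->
  (u \in inv_closure s) = (inv_key u \in map inv_key (1 :: -1 :: s)).
Proof.
move=> u0 /allP s0.
have nz w : w \in 1 :: -1 :: s -> w != 0.
  by rewrite !inE => /or3P[/eqP->|/eqP->|/s0 //]; rewrite ?oppr_eq0 oner_eq0.
have inv w : (w \in inv_closure s) = (w^-1 \in inv_closure s).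
  rewrite !inE !mem_cat invr_eq1 (inv_eq (@invrK F)) invrN invr1.
  have -> : (w^-1 \in map GRing.inv s) = (w \in s) by rewrite mem_map //; exact: invr_inj.
  have -> : (w \in map GRing.inv s) = (w^-1 \in s).
    by rewrite -{1}[w]invrK mem_map //; exact: invr_inj.
  by rewrite (orbC (w \in s)).
apply/idP/mapP => [|[w ws /inv_keyP]].
  rewrite /inv_closure -[_ :: _]/((1 :: -1 :: s) ++ map GRing.inv s) mem_cat.
  case/orP=> [us|/mapP[w ws ->]]; first by exists u.
  by exists w; rewrite ?inE ?ws ?orbT // /inv_key invrK addrC.
have wc : w \in inv_closure s.
  by rewrite /inv_closure -[_ :: _]/((1 :: -1 :: s) ++ map GRing.inv s) mem_cat ws.
by case/(_ u0 (nz w ws)) => e; [rewrite -e | rewrite (inv u) -e].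
Qed.

(** Besides 1 and -1, each class of the relation identifying u with 1 / u
    contributes two elements. *)
Lemma size_inv_closure s : all (fun w => w != 0) s ->
  (size (undup (inv_closure s)) + 2 =
   2 * size (undup (map inv_key (1 :: -1 :: s)%R)))%N.
Proof.
elim: s => [|u s IHs] /=.
  move=> _; rewrite !inE eq_sym (negPf opp1_neq1) /=.
  by rewrite /inv_key invrN invr1 -opprD -subr_eq0 opprK -mulr2n mulrn_eq0 -mulr2n pnatr_eq0.
case/andP=> u0 s0; have {}IHs := IHs s0.
have uV0 : u^-1 != 0 by rewrite invr_eq0.
have -> : size (undup (inv_closure (u :: s))) =
    size (undup (u :: u^-1 :: inv_closure s)).
  apply: eq_size_undup => w; rewrite /inv_closure /= !inE !mem_cat !inE.
  by case: (w == 1); case: (w == -1); case: (w == u); case: (w == u^-1);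
    rewrite ?orbT.
have -> : size (undup (map inv_key (1 :: -1 :: u :: s))) =
    size (undup (inv_key u :: map inv_key (1 :: -1 :: s))).
  apply: eq_size_undup => w; rewrite /= !inE.
  by case: (w == inv_key 1); case: (w == inv_key (-1)); case: (w == inv_key u).
have kV : inv_key u^-1 = inv_key u by rewrite /inv_key invrK addrC.
have uX := mem_inv_closure u0 s0; have uVX := mem_inv_closure uV0 s0.
have uK : u = 1 \/ u = -1 -> inv_key u \in map inv_key (1 :: -1 :: s).
  by case=> ->; rewrite /= !inE eqxx ?orbT.
rewrite kV in uVX; move: IHs uX uVX uK.
move: (inv_closure s) (map _ _) => X K IHs uX uVX uK /=.
rewrite in_cons uX uVX sqr_eq1 //.
have [ku|ku] := boolP (inv_key u \in K); first by rewrite orbT IHs.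
have -> : (u == 1) || (u == -1) = false.
  by apply/negP=> h; case/negP: ku; apply: uK; case/orP: h => /eqP; [left|right].
by rewrite /= !addSn IHs mulnS.
Qed.

End CountingInverses.

(** * Counting eigenvalues *)

Section EigenvalueCount.
Variable R : realType.
Local Notation C := (complex R).
Variable m : nat.
Hypothesis m0 : (0 < m)%N.
Variable a : {ffun 'I_2 -> 'I_m}.

Let lam (i : 'I_3) : C := chi (v i) (pt R a).
Let lam_neq0 i : lam i != 0. Proof. exact: chi_neq0. Qed.

(** The elements 0 and 1/2 of H stand for the eigenvalues 1 and -1.  The relation
    on H identifies the elements whose values are equal or inverse. *)
Definition Hvalue (h : Hset) : C :=
  match h with inl false => 1 | inl true => -1 | inr i => lam i end.

Lemma Hvalue_neq0 h : Hvalue h != 0.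
Proof. by case: h => [[]|i] //=; rewrite ?oppr_eq0 oner_eq0. Qed.

Lemma is_row_stratum x : is_row [set: 'I_9] x ->
  is_row (stratum a) x <-> chi x (pt R a) = 1.
Proof.
by move=> xP; split; [exact: is_row_chi | exact: chi_is_row].
Qed.

Lemma H_rule_value h h' : H_rule (stratum a) h h' ->
  inv_key (Hvalue h) = inv_key (Hvalue h').
Proof.
move=> r; apply/inv_keyP; rewrite ?Hvalue_neq0 //.
case: h h' r => [[]|i] [[]|j] //=.
- case/andP=> h /negP nv; left.
  have := is_row_chi R m0 (fintype.subxx _) h; rewrite chiZ -exprnP -/(lam i).
  move/eqP; rewrite sqrf_eq1 => /orP[/eqP e|/eqP //].
  by case: nv; apply/(is_row_stratum (is_row_v i)).
- by move/(is_row_chi R m0 (fintype.subxx _)) => e; left; rewrite /lam e.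
- case/orP=> /(is_row_chi R m0 (fintype.subxx _)); rewrite chiD ?chiN.
    by move/(mul_eq1 _ (lam_neq0 i)); right.
  by move/(div_eq1 _ (lam_neq0 j)); left.
Qed.

Lemma value_H_rule h h' : h != h' ->
  inv_key (Hvalue h) = inv_key (Hvalue h') ->
  H_rule (stratum a) h h' || H_rule (stratum a) h' h.
Proof.
move=> ne e.
have vrow i : inv_key (lam i) = inv_key 1 -> is_row (stratum a) (v i).
  by move/(inv_key1 (lam_neq0 i)) => ei; apply/(is_row_stratum (is_row_v i)).
have wrow i : inv_key (lam i) = inv_key (-1) ->
    is_row (stratum a) (2 *: v i) && ~~ is_row (stratum a) (v i).
  move/(inv_keyN1 (lam_neq0 i)) => ei; apply/andP; split.
    apply/(is_row_stratum (is_row_2v i)); rewrite chiZ -exprnP -/(lam i) ei.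
    by rewrite sqrrN expr1n.
  apply/negP=> /(is_row_stratum (is_row_v i)); rewrite -/(lam i) ei.
  by apply/eqP; exact: opp1_neq1.
have N1 : inv_key (-1 : C) <> inv_key 1.
  by move/inv_key1; rewrite oppr_eq0 oner_neq0 => /(_ isT)/eqP; rewrite (negPf (opp1_neq1 _)).
case: h h' ne e => [[]|i] [[]|j] ne e.
- by rewrite eqxx in ne.
- by case: N1.
- by rewrite [H_rule _ _ _]/= [H_rule _ (inr j) _]/= wrow.
- by case: N1.
- by rewrite eqxx in ne.
- by rewrite [H_rule _ _ _]/= [H_rule _ (inr j) _]/= vrow.
- by rewrite [H_rule _ _ _]/= wrow.
- by rewrite [H_rule _ _ _]/= vrow.
have ij : i != j by apply: contraNneq ne => ->.
apply/orP; left; apply/orP.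
have [el|el] := (inv_keyP (lam_neq0 i) (lam_neq0 j)).1 e; [right|left].
  apply/(is_row_stratum (is_row_vB ij)); rewrite chiD chiN.
  exact/(div_eq1 _ (lam_neq0 j)).
apply/(is_row_stratum (is_row_vD ij)); rewrite chiD.
exact/(mul_eq1 _ (lam_neq0 i)).
Qed.

Lemma H_equiv_value h h' :
  H_equiv (stratum a) h h' = (inv_key (Hvalue h) == inv_key (Hvalue h')).
Proof.
apply/idP/eqP => [/connectP[p]|e].
  elim: p h => [|g p IHp] h /=; first by move=> _ ->.
  case/andP=> hg /IHp{}IHp /IHp <-.
  by case/orP: hg => /H_rule_value.
have [->|ne] := eqVneq h h'; first exact: connect0.
by apply/connect1/value_H_rule.
Qed.

Let lams := map lam (enum 'I_3).

Lemma mem_lams i : lam i \in lams.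
Proof. by rewrite map_f ?mem_enum. Qed.

Lemma mem_lamsP u : reflect (exists i, lam i = u) (u \in lams).
Proof.
apply: (iffP idP) => [|[i <-]]; last exact: mem_lams.
by case/mapP=> i _ ->; exists i.
Qed.

Lemma card_H_classes : #|H_classes (stratum a)| =
  size (undup (map (@inv_key C) (1 :: -1 :: lams)))%R.
Proof.
rewrite /H_classes (card_equivalence_partition H_equiv_value).
apply: eq_size_undup => u; apply/mapP/mapP => -[h hH ->].
  case: h hH => [[]|i] _.
  - by exists (-1); rewrite // inE [_ \in _ :: _]in_cons eqxx orbT.
  - by exists 1; rewrite // inE eqxx.
  by exists (lam i); rewrite // !in_cons mem_lams !orbT.
move: hH; rewrite !in_cons => /orP[/eqP->|/orP[/eqP->|/mem_lamsP[i <-]]].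
- by exists (inl false); rewrite ?mem_enum.
- by exists (inl true); rewrite ?mem_enum.
by exists (inr i); rewrite ?mem_enum.
Qed.

Lemma half_class_singleton :
  (#|[set y | H_equiv (stratum a) (inl true) y]| == 1%N) = (-1 \notin lams).
Proof.
have key1 h : H_equiv (stratum a) (inl true) h = (Hvalue h == -1).
  rewrite H_equiv_value eq_sym; apply/eqP/eqP => [|->//].
  exact: inv_keyN1 (Hvalue_neq0 h).
rewrite (cardsD1 (inl true : Hset)) inE key1 eqxx add1n eqSS cards_eq0.
apply/eqP/idP => [e0|nl].
  apply/negP=> /mem_lamsP[i ei].
  have : (inr i : Hset) \in finset.set0 by rewrite -e0 !inE key1 /= ei eqxx.
  by rewrite finset.in_set0.
apply/setP=> h; rewrite !inE key1; apply/negP => /andP[hne /eqP hv].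
case: h hne hv => [[]|i] //= _.
  by move/esym/eqP; rewrite (negPf (opp1_neq1 _)).
by move=> e; case/negP: nl; rewrite -e mem_lams.
Qed.

(** The eigenvalues form the closure under inversion of the values at 1, 2, 3
    together with 1, and -1 is among them when the class of 1/2 is not a
    singleton: this is the case distinction in the definition of s_. *)
Lemma s_stratum : s_ (stratum a) = size (undup (1 :: lams ++ map GRing.inv lams)).
Proof.
have nz : all (fun u => u != 0) lams.
  by apply/allP=> u /mem_lamsP[i <-]; exact: lam_neq0.
have := size_inv_closure nz; rewrite /s_ half_class_singleton card_H_classes.
set c := (2 * _)%N => <-.
have N1 : (-1 \in 1 :: lams ++ map GRing.inv lams) = (-1 \in lams).
  rewrite inE (negPf (opp1_neq1 _)) /= mem_cat.
  have -> : (-1 \in map GRing.inv lams) = (-1 \in lams).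
    by rewrite -{1}(_ : (-1)^-1 = -1) ?mem_map //; [exact: invr_inj | rewrite invrN invr1].
  by rewrite orbb.
have -> : size (undup (inv_closure lams)) =
    (((-1)%R \notin lams) + size (undup (1%R :: lams ++ map GRing.inv lams)))%N.
  rewrite -N1; set t := 1 :: lams ++ _.
  rewrite (@eq_size_undup _ _ (-1 :: t)).
    by move: t => t /=; case: ifP.
  by move=> u; rewrite /t /inv_closure !in_cons orbCA.
move: (size _) => n; case: (-1 \in lams) => /=; lia.
Qed.

Lemma distinct_eigenvalues_torus s :
  distinct_eigenvalues (torus_elt (pt R a)) s <-> s_ (stratum a) = s.
Proof.
rewrite s_stratum /distinct_eigenvalues.
have -> : [set u | eigenvalue (torus_elt (pt R a)) u]%classic =
    [set u | u \in 1 :: lams ++ map GRing.inv lams]%classic.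
  apply/seteqP; rewrite torus_eltE.
  have mE u : eigenvalue (toral (e2pi (pt R a 0 0)) (e2pi (pt R a 0 0 - pt R a 1 0))
      (e2pi (pt R a 1 0 - 2 * pt R a 0 0))) u = (u \in 1 :: lams ++ map GRing.inv lams).
    rewrite eigenvalue_root_char char_poly_toral root_prod_XsubC /spectrum6.
    have e3 : enum 'I_3 =i [:: inord 0; inord 1; inord 2].
      by move=> i; rewrite mem_enum !inE; case: (inord3 i) => ->; rewrite eqxx ?orbT.
    have eV : u \in map GRing.inv lams =
        (u \in [:: (lam (inord 0))^-1; (lam (inord 1))^-1; (lam (inord 2))^-1]).
      by rewrite -map_comp (eq_mem_map _ e3).
    rewrite [RHS]in_cons mem_cat eV (eq_mem_map lam e3) [map _ _]/=.
    rewrite /lam -!e2pi_wt !wtE -!e2piN !opprB !in_cons.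
    move: (e2pi _) (e2pi _) (e2pi _) (e2pi _) (e2pi _) (e2pi _).
    move=> x y z x' y' z'; rewrite !in_nil !orbF.
    by case: (u == x); case: (u == y); case: (u == z); case: (u == x');
       case: (u == y'); case: (u == z'); rewrite ?orbT.
  by split=> u /=; rewrite mE.
split=> [e|<-]; last exact: card_mem_seq.
by apply/card_eq_II/(card_eq_trans _ e)/card_esym/card_mem_seq.
Qed.

End EigenvalueCount.

(** * Moebius inversion *)

Lemma mu_nprec T S : ~~ preceq T S -> mu T S = 0.
Proof.
move=> nTS; rewrite muE; case: eqP => [e|_].
  by rewrite e /preceq fintype.subxx in nTS.
by rewrite /prec properE -/(preceq T S) (negPf nTS).
Qed.

Lemma sum_mu_left T S : T \in Mposet -> S \in Mposet ->
  \sum_(U in Mposet) mu T U * (preceq U S)%:R = (T == S)%:R.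
Proof.
move=> TM SM.
have -> : \sum_(U in Mposet) mu T U * (preceq U S)%:R =
    \sum_(U in Mposet | preceq T U && preceq U S) mu T U.
  rewrite big_mkcondr /=; apply: eq_bigr => U _.
  have [TU|/mu_nprec ->] := boolP (preceq T U); last by rewrite mul0r.
  by case: (preceq U S); rewrite ?mulr1 ?mulr0.
have [<-|TS] := eqVneq T S.
  rewrite (big_pred1 T) => [|U]; first by rewrite muE eqxx.
  rewrite /preceq; apply/andP/eqP => [[_]|->].
    by rewrite -finset.eqEsubset eq_sym => /eqP.
  by rewrite fintype.subxx.
have [pTS|nTS] := boolP (prec T S).
  rewrite (bigD1 S) /=; last first.
    by rewrite SM /preceq fintype.subxx (proper_sub pTS).
  rewrite {1}muE (negPf TS) pTS; apply/eqP; rewrite addrC subr_eq0; apply/eqP.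
  apply: eq_bigl => U; rewrite /prec /preceq finset.properEneq (eq_sym S).
  by case: (U \in _); case: (U \subset T); case: (S \subset U); case: (U == S).
rewrite big_pred0 // => U; apply/negP => /andP[_ /andP[TU US]].
case/negP: nTS; rewrite /prec finset.properEneq eq_sym TS.
exact: fintype.subset_trans US TU.
Qed.

(** A one-sided inverse of a square matrix is two-sided, so the defining
    recursion of mu, which sums over its second argument, also holds for sums
    over the first. *)
Lemma sum_mu_right U S : U \in Mposet -> S \in Mposet ->
  \sum_(T in Mposet) (preceq U T)%:R * mu T S = (U == S)%:R.
Proof.
move=> UM SM.
pose e (i : 'I_#|Mposet|) : submat := enum_val i.
pose A : 'M[int]_#|Mposet| := \matrix_(i, j) mu (e i) (e j).
pose B : 'M[int]_#|Mposet| := \matrix_(i, j) (preceq (e i) (e j))%:R.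
have AB : A *m B = 1%:M.
  apply/matrixP=> i j; rewrite !mxE -(inj_eq enum_val_inj).
  rewrite -[RHS](sum_mu_left (enum_valP i) (enum_valP j)) [RHS]big_enum_val.
  by apply: eq_bigr => k _; rewrite !mxE.
have := congr1 (fun M : 'M[int]_#|Mposet| =>
  M (enum_rank_in UM U) (enum_rank_in UM S)) (mulmx1C AB).
rewrite !mxE -(inj_eq enum_val_inj) !enum_rankK_in // => <-.
rewrite [LHS]big_enum_val; apply: eq_bigr => k _.
by rewrite !mxE /e !enum_rankK_in.
Qed.

Section Strata.
Variable R : realType.
Variable m : nat.
Hypothesis m0 : (0 < m)%N.

Lemma card_by_stratum (Q : pred submat) :
  #|[set a : {ffun 'I_2 -> 'I_m} | Q (stratum a)]| =
  (\sum_(S in Mposet | Q S) f_ m S)%N.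
Proof.
rewrite -sum1_card (partition_big (@stratum m) (fun S => (S \in Mposet) && Q S)) /=.
  apply: eq_bigr => S /andP[SM QS]; rewrite (f_E _ SM) -sum1_card.
  by apply: eq_bigl => a; rewrite !inE; case: eqP => [->|]; rewrite ?QS ?andbF.
by move=> a; rewrite inE (stratum_in_Mposet R m0) => ->.
Qed.

Lemma moebius_inversion S : S \in Mposet ->
  (f_ m S)%:Z = \sum_(T in Mposet | preceq T S) mu T S * (g_ m T)%:Z.
Proof.
move=> SM.
have gE T : (g_ m T)%:Z = \sum_(U in Mposet) (preceq U T)%:R * (f_ m U)%:Z.
  rewrite g_E (card_by_stratum (fun U => T \subset U)).
  rewrite (big_morph Posz PoszD (erefl _)) big_mkcondr.
  by apply: eq_bigr => U _; rewrite /preceq; case: ifP; rewrite ?mul1r ?mul0r.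
have -> : \sum_(T in Mposet | preceq T S) mu T S * (g_ m T)%:Z =
    \sum_(T in Mposet) mu T S * (g_ m T)%:Z.
  rewrite big_mkcondr; apply: eq_bigr => T _.
  by case: ifP => // /negbT /mu_nprec ->; rewrite mul0r.
under eq_bigr do rewrite gE mulr_sumr.
rewrite exchange_big /= (bigD1 S) //= [X in _ + X]big1 ?addr0.
  under eq_bigr do rewrite mulrCA mulrA.
  by rewrite -mulr_suml sum_mu_right // eqxx mul1r.
move=> U /andP[UM US]; under eq_bigr do rewrite mulrCA mulrA.
by rewrite -mulr_suml sum_mu_right // (negPf US) mul0r.
Qed.

End Strata.

(** * The action of the Weyl group on the torsion points *)

Section Classes.
Variable R : realType.
Local Notation C := (complex R).

Lemma distinct_eigenvalues_conj (g x : 'M[C]_7) s : g \in unitmx ->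
  distinct_eigenvalues (g *m x *m invmx g) s <-> distinct_eigenvalues x s.
Proof.
move=> ug; have e u : eigenvalue (g *m x *m invmx g) u = eigenvalue x u.
  by rewrite !eigenvalue_root_char char_poly_conjugate.
have sE : [set u | eigenvalue (g *m x *m invmx g) u]%classic =
    [set u | eigenvalue x u]%classic.
  by apply/seteqP; split=> u; rewrite /mkset e.
rewrite /distinct_eigenvalues.
rewrite [X in (X #= _)%card <-> _]sE.
exact: iff_refl.
Qed.

Lemma torus_elt_G2 (k : 'cV[C]_2) : G2 (torus_elt k).
Proof. by apply/G2P; rewrite torus_eltE; apply/g2_toral/triple_torus_elt. Qed.

Lemma conj_class_refl (x : 'M[C]_7) : conj_class x x.
Proof.
by exists 1%:M; [apply/G2P; exact: g2_1 | rewrite mul1mx invmx1 mulmx1].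
Qed.

Lemma conj_class_eq (g x : 'M[C]_7) : g2 g ->
  conj_class (g *m x *m invmx g) = conj_class x.
Proof.
move=> gg; have [ug _ _] := gg.
have sub (h y : 'M[C]_7) : g2 h -> (conj_class (h *m y *m invmx h) `<=` conj_class y)%classic.
  move=> gh _ [f /G2P gf <-]; have [uh _ _] := gh; have [uf _ _] := gf.
  exists (f *m h); first by apply/G2P; exact: g2M.
  by rewrite conjmxM.
apply/seteqP; split; first exact: sub.
by have := sub _ (g *m x *m invmx g) (g2V gg); rewrite invmxK conjmxVK.
Qed.

Variables (m : nat) (m0 : (0 < m)%N).
Local Notation X := {ffun 'I_2 -> 'I_m}.
Local Notation t a := (torus_elt (pt R a)).

Lemma torsion_class (x : 'M[C]_7) : G2 x -> x ^+ m = 1 ->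
  exists2 g, g2 g & exists a : X, x = g *m t a *m invmx g.
Proof.
move=> /G2P gx xm.
have [g [u [v [w [gg p tm xE]]]]] := finite_order_toral m0 xm gx.
by exists g => //; have [a aE] := toral_torsion m0 p tm; exists a; rewrite aE.
Qed.

Variables (gT : finGroupType) (W : {group gT}) (q : 'M[C]_7 -> gT).
Hypothesis hW : is_weyl_group W q.

Lemma weyl_move w (a : X) : w \in W -> exists a' : X,
  forall n, torus_normalizer n -> q n = w -> n *m t a' *m invmx n = t a.
Proof.
move=> wW; have [n0 nN0 qn0] := weyl_lift hW wW.
have un0 := torus_normalizer_unit nN0.
have [_ _ surj] := (torus_normalizerP n0).1 nN0; have [k e] := surj (pt R a).
have km : torus_elt k ^+ m = 1.
  by apply: (conj_expr_eq1 un0); rewrite e; exact: torus_elt_pt_torsion.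
have [a' a'E] := torus_elt_torsion m0 km; exists a' => n nN qn.
rewrite -a'E (weyl_lift_unique hW nN nN0) //.
by rewrite qn qn0.
Qed.

(** A right action, so w acts by the inverse of the conjugation by its lifts. *)
Definition weyl_act (a : X) (w : gT) : X :=
  if w \in W then odflt a [pick a' : X |
    `[< forall n, torus_normalizer n -> q n = w -> n *m t a' *m invmx n = t a >]]
  else a.

Lemma weyl_actP w (a : X) n : w \in W -> torus_normalizer n -> q n = w ->
  n *m t (weyl_act a w) *m invmx n = t a.
Proof.
move=> wW nN qn; rewrite /weyl_act wW; case: pickP => [a' /asboolP|none].
  exact.
have [a' a'P] := weyl_move a wW.
by have := none a'; rewrite asboolT.
Qed.

Lemma weyl_act_unique w (a a' : X) n : w \in W -> torus_normalizer n ->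
  q n = w -> n *m t a' *m invmx n = t a -> weyl_act a w = a'.
Proof.
move=> wW nN qn e; apply: (torus_elt_pt_inj m0 (R := R)).
have un := torus_normalizer_unit nN.
exact: (conjmx_inj un (etrans (weyl_actP a wW nN qn) (esym e))).
Qed.

Lemma weyl_act_is_action : is_action W weyl_act.
Proof.
split=> [w a b|a w w' wW wW'].
  have [wW|wW] := boolP (w \in W); last by rewrite /weyl_act (negPf wW).
  have [n nN qn] := weyl_lift hW wW.
  move=> e; apply: (torus_elt_pt_inj m0 (R := R)).
  have ea := weyl_actP a wW nN qn; rewrite e in ea.
  exact: (etrans (esym ea) (weyl_actP b wW nN qn)).
have [n nN qn] := weyl_lift hW wW; have [n' nN' qn'] := weyl_lift hW wW'.
have nN2 := torus_normalizerM nN nN'.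
apply: (weyl_act_unique (n := n *m n')) => //; first exact: groupM.
  by case: hW => qM _ _; rewrite qM // qn qn'.
by rewrite conjmxM ?torus_normalizer_unit // !weyl_actP.
Qed.

Canonical weyl_action := Action weyl_act_is_action.

Variable s : nat.
Definition torsion_points : {set X} := [set a | s_ (stratum a) == s].

Lemma torsion_pointsP (a : X) :
  reflect (distinct_eigenvalues (t a) s) (a \in torsion_points).
Proof.
rewrite inE; apply: (iffP eqP) => [e|/(@distinct_eigenvalues_torus R m m0 a s)//].
exact/(@distinct_eigenvalues_torus R m m0 a s).
Qed.

Lemma weyl_acts : [acts W, on torsion_points | weyl_action].
Proof.
apply/fintype.subsetP=> w wW; rewrite finset.in_setI wW inE.
apply/fintype.subsetP=> a /torsion_pointsP aS; rewrite inE.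
have [n nN qn] := weyl_lift hW wW; have un := torus_normalizer_unit nN.
change (weyl_act a w \in torsion_points); apply/torsion_pointsP.
apply: (@distinct_eigenvalues_conj n (t (weyl_act a w)) s un).1.
have e := weyl_actP a wW nN qn; rewrite e.
exact: aS.
Qed.

Lemma card_fixed_points w : w \in W ->
  #|('Fix_(torsion_points | weyl_action)[w])%g| =
  (\sum_(S in Mposet | (s_ S == s) && preceq S (S_of (sigma q w))) f_ m S)%N.
Proof.
move=> wW; have [n nN qn] := weyl_lift hW wW.
have fixE (a : X) :
    (a \in 'Fix_weyl_action[w]%g) = preceq (stratum a) (S_of (sigma q w)).
  rewrite /preceq -killsE; apply/afix1P/idP => [e|].
    apply/(fixed_iff_kills m0 hW a wW nN qn).
    have := weyl_actP a wW nN qn; rewrite [weyl_act a w]e.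
    exact.
  move/(fixed_iff_kills m0 hW a wW nN qn).
  exact: (weyl_act_unique wW nN qn).
rewrite -(card_by_stratum R m0).
by apply: eq_card => a; rewrite finset.in_setI fixE !inE.
Qed.

End Classes.

(** * Counting conjugacy classes *)

Section Counting.
Variable R : realType.
Local Notation C := (complex R).
Variables (m : nat) (m0 : (0 < m)%N).
Local Notation X := {ffun 'I_2 -> 'I_m}.
Local Notation t a := (torus_elt (pt R a)).
Variables (gT : finGroupType) (W : {group gT}) (q : 'M[C]_7 -> gT).
Hypothesis hW : is_weyl_group W q.
Variable s : nat.
Local Notation act := (weyl_action m0 hW).
Local Notation points := (torsion_points m s).

Lemma torus_elt_fused g (k k' : 'cV[C]_2) : g \in unitmx ->
  g *m torus_elt k *m invmx g = torus_elt k' -> fused (torus_elt k) (torus_elt k').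
Proof.
rewrite !torus_eltE; apply: conjugate_fused; exact: triple_torus_elt.
Qed.

Lemma weyl_image n : torus_normalizer n -> q n \in W.
Proof.
move=> nN; case: hW => _ qW _.
have : (q @` @torus_normalizer R)%classic (q n) by exists n.
by rewrite qW.
Qed.

(** Conjugate points of the torus are fused, that is conjugate under the
    normalizer. *)
Lemma conj_class_orbit (a b : X) :
  conj_class (t a) = conj_class (t b) <-> a \in orbit act W b.
Proof.
split=> [e|/orbitP[w wW <-]].
  have : conj_class (t a) (t b) by rewrite e; exact: conj_class_refl.
  case=> g /G2P[ug _ _] ge.
  have [n nN nE] : fused (t a) (t b).
    exact: (torus_elt_fused ug ge).
  apply/orbitP; exists (q n); first exact: weyl_image.
  exact: (weyl_act_unique m0 hW (weyl_image nN) nN).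
have [n nN qn] := weyl_lift hW wW.
have e := weyl_actP m0 hW b wW nN qn.
by rewrite -[RHS](congr1 (@conj_class R) e) conj_class_eq //; case/torus_normalizerP: nN.
Qed.

Lemma card_G2_classes :
  (@G2_classes R m s #= `I_#|orbit act W @: points|)%card.
Proof.
pose g (O : {set X}) : set 'M[C]_7 :=
  [set y | exists2 a, a \in O & conj_class (t a) y]%classic.
have gE a : g (orbit act W a) = conj_class (t a).
  apply/seteqP; split=> [y [b]|y ya].
    by move/conj_class_orbit => e yb; rewrite -e.
  by exists a; first exact: orbit_refl.
have -> : @G2_classes R m s =
    [set y | exists2 O, O \in enum (orbit act W @: points) & g O = y]%classic.
  apply/seteqP; split=> [_ [x [Gx xm xs] <-]|_ [O + <-]].
    have [h gh [a xE]] := torsion_class m0 Gx xm; have [uh _ _] := gh.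
    have aP : a \in points.
      apply/(torsion_pointsP R m0).
      apply: (@distinct_eigenvalues_conj R h (t a) s uh).1.
      by rewrite xE in xs.
    exists (orbit act W a); first by rewrite mem_enum; apply: imset_f.
    by rewrite gE xE conj_class_eq.
  rewrite mem_enum => /imsetP[a /(torsion_pointsP R m0) aP ->]; rewrite gE.
  exists (t a) => //; split=> //; first exact: torus_elt_G2.
  exact: torus_elt_pt_torsion.
rewrite [X in `I_X]cardE; apply: card_image_uniq; first exact: enum_uniq.
move=> O O'; rewrite !mem_enum => /imsetP[a _ ->] /imsetP[b _ ->].
rewrite !gE => /conj_class_orbit ab.
by apply/orbit_in_eqP.
Qed.

Lemma card_fixed_conj w h : w \in W -> h \in W ->
  (#|('Fix_(points | act)[w])%g| <= #|('Fix_(points | act)[w ^ h])%g|)%N.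
Proof.
move=> wW hWW; rewrite -(card_imset _ (act_inj act h)); apply: subset_leq_card.
apply/fintype.subsetP=> _ /imsetP[a + ->]; rewrite !finset.in_setI => /andP[aP /afix1P aw].
rewrite (acts_act (weyl_acts m0 hW s)) // aP; apply/afix1P.
by rewrite -actMin ?groupJ // -conjgC actMin // aw.
Qed.

(** The orbit counting formula, grouped by conjugacy classes. *)
Lemma sum_over_classes (rep : {set gT} -> gT) :
  (forall c : {set gT}, c \in classes W -> rep c \in c) ->
  (\sum_(c in classes W) #|c| * #|('Fix_(points | act)[rep c])%g| =
   #|orbit act W @: points| * #|W|)%N.
Proof.
move=> repP; rewrite -(Frobenius_Cauchy (weyl_acts m0 hW s)).
rewrite [RHS](partition_big (fun w => w ^: W)%g (mem (classes W))) /=; last first.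
  by move=> w wW; exact: mem_classes.
apply: eq_bigr => c cW; rewrite -sum_nat_const.
have cE w : (w \in W) && ((w ^: W)%g == c) = (w \in c).
  case/imsetP: cW => x xW ->; apply/andP/idP => [[wW /eqP <-]|wx].
    exact: class_refl.
  by rewrite (fintype.subsetP (class_subG xW (fintype.subxx W))) // (class_eqP wx).
rewrite (eq_bigl _ _ cE); apply: eq_bigr => w wc.
have repc := repP c cW; rewrite -cE in wc; case/andP: wc => wW /eqP cw.
have : rep c \in (w ^: W)%g by rewrite cw.
case/imsetP=> h hWW ->.
apply/eqP; rewrite eqn_leq card_fixed_conj // andbT.
by rewrite -{2}(conjgK h w) card_fixed_conj ?groupJ ?groupV.
Qed.

End Counting.

Theorem corollary4p14 (R : realType) (gT : finGroupType) (W : {group gT})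
    (q : 'M[complex R]_7 -> gT) (hW : is_weyl_group W q)
    (rep : {set gT} -> gT) (hrep : forall c : {set gT}, c \in classes W -> rep c \in c)
    (m s : nat) (hm : (0 < m)%N) (hs : (0 < s)%N) :
  (exists N : nat,
     (@G2_classes R m s #= `I_N)%card /\
     N%:R = (#|W|%:R)^-1 *
       \sum_(c in classes W) #|c|%:R *
         \sum_(S in Mposet |
                (s_ S == s) && preceq S (S_of (sigma q (rep c))))
           (f_ m S)%:R :> rat)
  /\
  (forall S : submat, S \in Mposet ->
     (f_ m S)%:Z = \sum_(T in Mposet | preceq T S) mu T S * (g_ m T)%:Z).
Proof.
split; last by move=> S; exact: (moebius_inversion R hm).
exists #|orbit (weyl_action hm hW) W @: torsion_points m s|.
split; first exact: card_G2_classes.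
have W0 : (#|W|%:R : rat) != 0 by rewrite pnatr_eq0 -lt0n cardG_gt0.
apply: (mulfI W0); rewrite mulVKf // mulrC -natrM -(sum_over_classes hm hW s hrep).
rewrite natr_sum; apply: eq_bigr => c cW; rewrite natrM; congr (_ * _).
have cP : rep c \in W.
  case/imsetP: (cW) (hrep c cW) => x xW ->.
  by apply: (fintype.subsetP (class_subG xW (fintype.subxx W))).
by rewrite (card_fixed_points hm hW s cP) natr_sum.
Qed.
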